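(* There exists an even unimodular lattice $L\subseteq\mathbb{R}^{32}$, with root system $L(2)=\{x\in L:x\cdot x=2\}$ of type $A_1^8A_3^8$ (the orthogonal sum of eight copies of $A_1$ and eight copies of $A_3$), which is not a critical point of the $f_\alpha$-potential energy for $\alpha=14$, i.e. for the Gaussian potential function $r\mapsto e^{-14r}$.
   Context: A lattice $L\subseteq\mathbb{R}^n$ (discrete subgroup of full rank) is unimodular if it equals its dual $L^*=\{y\in\mathbb{R}^n: x\cdot y\in\mathbb{Z}\ \forall x\in L\}$, and even if $x\cdot x$ is an even integer for all $x\in L$. For $\alpha>0$ let $f_\alpha(r)=e^{-\alpha r}$ and $\mathcal{E}(f_\alpha,L)=\sum_{x\in L\setminus\{0\}}e^{-\alpha\|x\|^2}$. The manifold of rank $n$ lattices of point density $1$ (one lattice point per unit volume) is parametrized by positive definite symmetric $n\times n$ matrices $Y$ of determinant $1$: with $L$ fixed (of density $1$), the energy function is $F_{\alpha,L}(Y)=\sum_{x\in L\setminus\{0\}}e^{-\alpha x^{\mathsf T}Yx}$, with $L$ itself corresponding to $Y=I_n$. The tangent space at $I_n$ is the space of symmetric matrices $H$ of trace zero. $L$ is critical for the $f_\alpha$-potential energy if the gradient at $I_n$ vanishes, i.e. $-\alpha\sum_{x\in L\setminus\{0\}}(x^{\mathsf T}Hx)\,e^{-\alpha\|x\|^2}=0$ for every symmetric trace-zero matrix $H$. *)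

(* Defs.v *)
From HB Require Import structures.
From mathcomp Require Export all_boot all_order all_algebra.
From mathcomp Require Export all_classical all_reals all_analysis.

Set Implicit Arguments.
Unset Strict Implicit.
Unset Printing Implicit Defensive.

Import Order.TTheory GRing.Theory Num.Theory.
Import numFieldNormedType.Exports.

Local Open Scope classical_set_scope.
Local Open Scope ring_scope.

Definition dot (R : realType) (n : nat) (x y : 'cV[R]_n) : R :=
  (x^T *m y) 0 0.

Definition qform (R : realType) (n : nat) (Y : 'M[R]_n) (x : 'cV[R]_n) : R :=
  (x^T *m Y *m x) 0 0.

(* For a discrete subgroup, the rank is the dimension of its linear span, so
   full rank means that no proper subspace contains [L]. *)
Definition is_lattice (R : realType) (n : nat) (L : set 'cV[R]_n) : Prop :=
  [/\ L 0,
      forall x y, L x -> L y -> L (x - y),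
      L `<=` isolated L
    & forall V : {vspace 'cV[R]_n}, L `<=` [set x | x \in V] -> V = fullv].

Definition dual_lattice (R : realType) (n : nat) (L : set 'cV[R]_n) :
    set 'cV[R]_n :=
  [set y | forall x, L x -> dot x y \is a Num.int].

Definition unimodular (R : realType) (n : nat) (L : set 'cV[R]_n) : Prop :=
  L = dual_lattice L.

Definition even_lattice (R : realType) (n : nat) (L : set 'cV[R]_n) : Prop :=
  forall x, L x -> exists k : int, dot x x = (2 * k)%:~R.

Definition norm2_vectors (R : realType) (n : nat) (L : set 'cV[R]_n) :
    set 'cV[R]_n :=
  [set x | L x /\ dot x x = 2].

(* The root system A_m in its standard coordinates in R^(m+1):
   the vectors e_i - e_j with i <> j. *)
Definition root_system_A (R : realType) (m : nat) : set 'cV[R]_m.+1 :=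
  [set x | exists i j : 'I_m.+1,
     i != j /\ x = delta_mx i 0 - delta_mx j 0].

(* The ambient spaces may differ: only the inner products between elements of
   [Phi] have to be preserved, i.e. [g] is isometric on the span of [Phi]. *)
Definition isometric_image (R : realType) (m n : nat)
    (Phi : set 'cV[R]_m) (Psi : set 'cV[R]_n) : Prop :=
  exists g : 'M[R]_(n, m),
    (forall x y, Phi x -> Phi y -> dot (g *m x) (g *m y) = dot x y) /\
    [set g *m x | x in Phi] = Psi.

(* [Phi] is the orthogonal sum of root systems A_m, [m] ranging over [ms]
   with multiplicity. All roots involved have squared norm 2, so the components
   are compared with the A_m by isometries, with no rescaling. *)
Definition has_type_A (R : realType) (n : nat) (ms : seq nat)
    (Phi : set 'cV[R]_n) : Prop :=
  exists Psi : 'I_(size ms) -> set 'cV[R]_n,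
    [/\ forall i : 'I_(size ms),
          isometric_image (@root_system_A R (nth 0%N ms i)) (Psi i),
        forall i j, i != j -> forall x y, Psi i x -> Psi j y -> dot x y = 0
      & Phi = [set x | exists i, Psi i x]].

Definition gaussian (R : realType) (alpha r : R) : R := expR (- alpha * r).

(* The sum of non-negative terms is formed in the extended reals. For
   [alpha > 0] and a lattice [L] it is finite whenever [Y] is positive definite,
   and near the identity; [fine] discards nothing there. *)
Definition energy (R : realType) (n : nat) (alpha : R) (L : set 'cV[R]_n)
    (Y : 'M[R]_n) : R :=
  fine (\esum_(x in L `\ 0%R) (gaussian alpha (qform Y x))%:E)%E.

(* [energy] is given by the same formula on all matrices, and is smooth near
   the identity when [L] is a lattice and [alpha > 0]. Hence the gradient at the
   identity of its restriction to the manifold of positive definite symmetric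
   matrices of determinant 1 vanishes iff the directional derivatives of
   [energy] vanish along the tangent space of that manifold, which consists of
   the symmetric matrices of trace 0. Since ['D_H] is 0 where the limit does not
   exist, [~ critical alpha L] provides a derivative that exists and is not 0. *)
Definition critical (R : realType) (n : nat) (alpha : R) (L : set 'cV[R]_n) :
    Prop :=
  forall H : 'M[R]_n, H^T = H -> \tr H = 0 ->
    'D_H (energy alpha L) (1%:M : 'M[R]_n) = 0.

(* Main.v *)
Require Import Defs.
From mathcomp Require Import finmap ring lra zify.

(** The lattice [L32] contains the root lattice A1^8 A3^8, presented as eight
    blocks [sqrt 2 Z (+) D3] of [R^4], and is obtained from it by adjoining a
    self-dual glue code of order 2^12. Its Gram matrix is integral, even and has
    an explicit integral inverse. No nonzero class of the glue code contains a
    vector of norm less than 4, so the vectors of norm 2 are the roots.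

    Along [H = E_00 - E_11], where coordinate 0 spans the A1 and coordinate 1
    lies in the A3 of the first block, the derivative of the energy is
    [-14 * (A - B)] with [A] and [B] the sums of [x_0 ^ 2] and [x_1 ^ 2] against
    [exp (- 14 |x|^2)]. The Coxeter numbers 2 and 4 make the roots contribute
    [4 exp (- 28)] to [A] and [8 exp (- 28)] to [B]. All other vectors have norm
    at least 4 and contribute to [A] at most [4 exp (- 44)] times the theta
    series [sum_x exp (- 3 |x|^2)], which is less than [exp 16]. *)

Set Implicit Arguments.
Unset Strict Implicit.
Unset Printing Implicit Defensive.

Import Order.TTheory GRing.Theory Num.Theory.
Import numFieldNormedType.Exports.

Local Open Scope classical_set_scope.
Local Open Scope ring_scope.

(** * Lattices spanned by a basis with integral Gram matrix *)

Section Dot.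
Context {R : realType} {n : nat}.
Implicit Types x y : 'cV[R]_n.

Lemma dotE x y : dot x y = \sum_i x i 0 * y i 0.
Proof. by rewrite /dot mxE; apply: eq_bigr => i _; rewrite mxE. Qed.

Lemma dotC x y : dot x y = dot y x.
Proof. by rewrite !dotE; apply: eq_bigr => i _; rewrite mulrC. Qed.

Lemma dotDl x y z : dot (x + y) z = dot x z + dot y z.
Proof. by rewrite /dot linearD mulmxDl mxE. Qed.

Lemma dotZl a x y : dot (a *: x) y = a * dot x y.
Proof. by rewrite /dot linearZ -scalemxAl mxE. Qed.

Lemma dotxx_ge0 x : 0 <= dot x x.
Proof. by rewrite dotE sumr_ge0 // => i _; rewrite -expr2 sqr_ge0. Qed.

Lemma dotxx_eq0 x : (dot x x == 0) = (x == 0).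
Proof.
rewrite dotE psumr_eq0; last by move=> i _; rewrite -expr2 sqr_ge0.
apply/allP/eqP => [h|-> i _]; last by rewrite !mxE mulr0 eqxx.
apply/matrixP => i j; rewrite (ord1 j) mxE; apply/eqP.
by have := h i (mem_index_enum i); rewrite mulf_eq0 orbb.
Qed.

End Dot.

Section IntegralLattice.
Context {R : realType} {n : nat}.
Implicit Types (B : 'M[R]_n) (G : 'M[int]_n).

Definition int_span B : set 'cV[R]_n :=
  [set x | exists c : 'cV[int]_n, x = B *m map_mx intr c].

Lemma int_span_lin B (u v : 'cV[R]_n) (k : int) :
  int_span B u -> int_span B v -> int_span B (k%:~R *: u + v).
Proof.
move=> [c ->] [c' ->]; exists (k *: c + c').
by rewrite map_mxD map_mxZ mulmxDr scalemxAr.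
Qed.

Lemma int_span0 B : int_span B 0.
Proof. by exists 0; rewrite map_mx0 mulmx0. Qed.

Lemma int_spanB B u v : int_span B u -> int_span B v -> int_span B (u - v).
Proof.
move=> hu hv; rewrite addrC -scaleN1r -[-1]/((-1)%:~R).
exact: int_span_lin.
Qed.

Lemma dot_int_span B G (c c' : 'cV[int]_n) : B^T *m B = map_mx intr G ->
  dot (B *m map_mx intr c) (B *m map_mx intr c') =
  ((c^T *m G *m c') 0 0)%:~R.
Proof.
move=> BG; rewrite /dot trmx_mul mulmxA -(mulmxA _ B^T) BG map_trmx.
by rewrite -!map_mxM mxE.
Qed.

Lemma dot_int_span_int B G x y : B^T *m B = map_mx intr G ->
  int_span B x -> int_span B y -> dot x y \is a Num.int.
Proof. by move=> BG [c ->] [c' ->]; rewrite (dot_int_span _ _ BG) intr_int. Qed.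

Lemma int_span_col B i : int_span B (col i B).
Proof.
exists (delta_mx i 0); apply/matrixP => j k; rewrite !mxE (bigD1 i)//= big1.
  by rewrite !mxE !eqxx (ord1 k) eqxx/= mulr1 addr0.
by move=> l /negbTE li; rewrite !mxE li/= mulr0.
Qed.

Lemma mul_int_span_inv B G Gi : B^T *m B = map_mx intr G -> G *m Gi = 1%:M ->
  B *m (map_mx intr Gi *m B^T) = 1%:M.
Proof.
move=> BG GG; apply: mulmx1C.
by rewrite -mulmxA BG -map_mxM (mulmx1C GG) map_mx1.
Qed.

(** Distinct lattice vectors differ by a vector of positive integral squared norm, hence at least 1,
    which gives discreteness. The columns of [B] span because [B] is invertible. *)
Lemma int_span_lattice B G Gi :
  B^T *m B = map_mx intr G -> G *m Gi = 1%:M -> is_lattice (int_span B).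
Proof.
move=> BG GG; split; first exact: int_span0.
- exact: int_spanB.
- move=> x Lx; split; first exact/mem_set.
  (* Balls are entrywise: a difference of radius [1/(n+1)] has squared norm at most [n/(n+1)], which
     is below 1. *)
  exists (ball x n.+1%:R^-1); first by apply: nbhsx_ballx; rewrite invr_gt0.
  apply/seteqP; split=> [y [xy Ly]|_ ->]; last first.
    by split => //; apply: ballxx; rewrite invr_gt0.
  have dint := dot_int_span_int BG (int_spanB Lx Ly) (int_spanB Lx Ly).
  apply/esym/eqP; rewrite -subr_eq0 -dotxx_eq0.
  have [k hk] := intrP dint.
  have : dot (x - y) (x - y) < 1.
    rewrite dotE (@le_lt_trans _ _ (\sum_(i < n) n.+1%:R^-1)) //.
      apply: ler_sum => i _; rewrite -expr2 -real_normK ?num_real// expr2.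
      have [_ /(_ i 0)] := xy; rewrite /ball/= !mxE => /ltW xyi.
      by rewrite -[leRHS]mulr1 ler_pM// (le_trans xyi)// invf_le1 ?ler1n.
    rewrite sumr_const card_ord -[ltLHS]mulr_natl ltr_pdivrMr ?mul1r ?ltr_nat//.
  have := dotxx_ge0 (x - y).
  rewrite hk ler0z ltrz1 intr_eq0.
  by case: k {hk} => [[|k]|k].
- move=> V LV; apply/eqP; rewrite eqEsubv subvf/=; apply/subvP => x _.
  rewrite -[x]mul1mx -(mul_int_span_inv BG GG) -mulmxA.
  set c := _ *m x; have -> : B *m c = \sum_i c i 0 *: col i B.
    apply/matrixP => j k; rewrite summxE !mxE (ord1 k).
    by apply: eq_bigr => i _; rewrite !mxE mulrC.
  by apply: rpred_sum => i _; apply/rpredZ/LV/int_span_col.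
Qed.

(** [B^T y] is an integral vector [c], and [y = B (Gi c)] because [Gi B^T] inverts [B]. *)
Lemma mem_int_span_dual B G Gi y :
  B^T *m B = map_mx intr G -> G *m Gi = 1%:M ->
  (forall i, dot (col i B) y \is a Num.int) -> int_span B y.
Proof.
move=> BG GG Ly.
have /choice[c hc] : forall i, exists k : int, (B^T *m y) i 0 = k%:~R.
  move=> i; have /intrP[k hk] := Ly i.
  by exists k; rewrite -hk /dot tr_col -row_mul !mxE.
exists (Gi *m \col_i c i); rewrite map_mxM.
have -> : map_mx intr (\col_i c i) = B^T *m y.
  by apply/matrixP => i j; rewrite (ord1 j) hc !mxE.
by rewrite (mulmxA _ B^T) mulmxA (mul_int_span_inv BG GG) mul1mx.
Qed.

Lemma int_span_unimodular B G Gi :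
  B^T *m B = map_mx intr G -> G *m Gi = 1%:M -> unimodular (int_span B).
Proof.
move=> BG GG; apply/seteqP; split=> [y Ly x Lx|y Ly].
  by rewrite /=; apply: (dot_int_span_int BG).
by apply: mem_int_span_dual BG GG _ => i; apply/Ly/int_span_col.
Qed.

(** Modulo 2 the squared norm is additive on an integral lattice, since the cross term occurs twice;
    so the diagonal of [G] decides. *)
Lemma int_span_even B G : B^T *m B = map_mx intr G ->
  (forall i, exists k : int, G i i = 2 * k) -> even_lattice (int_span B).
Proof.
move=> BG Gev.
pose E y := int_span B y /\ exists k : int, dot y y = (2 * k)%:~R.
suff colE (c : 'cV[int]_n) : E (\sum_i (c i 0)%:~R *: col i B).
  move=> x [c ->]; have [_] := colE c.
  suff -> : B *m map_mx intr c = \sum_i (c i 0)%:~R *: col i B by [].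
  apply/matrixP => j k; rewrite summxE !mxE (ord1 k).
  by apply: eq_bigr => i _; rewrite !mxE mulrC.
elim/big_ind: _ => [|u v [Lu [k hk]] [Lv [l hl]]|i _].
- split; first exact: int_span0.
  by exists 0; rewrite mulr0 dotE big1// => i _; rewrite mxE mul0r.
- split; first by rewrite -[u]scale1r; apply: (int_span_lin 1).
  have [m hm] := intrP (dot_int_span_int BG Lu Lv).
  exists (k + l + m); rewrite dotDl !(dotC _ (u + v)) !dotDl hk hl.
  rewrite (dotC v u) hm -!intrD; congr intmul; ring.
- split.
    by rewrite -[_ *: _]addr0; apply/int_span_lin/int_span0/int_span_col.
  have [k hk] := Gev i; exists (c i 0 ^+ 2 * k).
  rewrite dotZl dotC dotZl.
  have -> : dot (col i B) (col i B) = (G i i)%:~R.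
    have -> : dot (col i B) (col i B) = (B^T *m B) i i.
      by rewrite dotE !mxE; apply: eq_bigr => j _; rewrite !mxE.
    by rewrite BG mxE.
  rewrite hk -!intrM; congr intmul; ring.
Qed.

End IntegralLattice.

(** * The glue code *)

(* Rows are basis vectors, eight glue vectors followed by 24 roots. An integer
   vector [z] stands for the vector of [R^32] with coordinates
   [z_k * sqrt 2 / 2] if [4 | k] and [z_k / 2] otherwise. *)
Definition basis_rows : seq (seq int) := [::
  [:: 0; 1; 1; 1; 0; 0; 0; 0; 0; 0; 0; 0; 0; 0; 0; 0; 1; 0; 0; 0; 0; 1; 1; 1; 0; 1; 1; 1; 1; 1; 1; 1];
  [:: 0; 0; 0; 0; 0; 1; 1; 1; 0; 0; 0; 0; 0; 0; 0; 0; 1; 1; 1; 1; 1; 0; 0; 0; 0; 1; 1; 1; 0; 1; 1; 1];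
  [:: 0; 0; 0; 0; 0; 0; 0; 0; 0; 1; 1; 1; 0; 0; 0; 0; 0; 1; 1; 1; 1; -1; -1; -1; 1; 0; 0; 0; 0; 1; 1; 1];
  [:: 0; 0; 0; 0; 0; 0; 0; 0; 0; 0; 0; 0; 0; 1; 1; 1; 0; -1; -1; -1; 0; 1; 1; 1; 1; 1; 1; 1; 1; 0; 0; 0];
  [:: 1; 0; 0; 0; 0; 0; 0; 0; 0; 0; 0; 0; 0; 0; 0; 0; 0; 2; 0; 0; 1; 2; 0; 0; 1; 0; 0; 0; 1; 0; 0; 0];
  [:: 0; 0; 0; 0; 1; 0; 0; 0; 0; 0; 0; 0; 0; 0; 0; 0; 1; 0; 0; 0; 0; 2; 0; 0; 1; 2; 0; 0; 1; 0; 0; 0];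
  [:: 0; 0; 0; 0; 0; 0; 0; 0; 1; 0; 0; 0; 0; 0; 0; 0; 1; 0; 0; 0; 1; 0; 0; 0; 0; 2; 0; 0; 1; 2; 0; 0];
  [:: 0; 0; 0; 0; 0; 0; 0; 0; 0; 0; 0; 0; 1; 0; 0; 0; 1; 2; 0; 0; 1; 0; 0; 0; 1; 0; 0; 0; 0; 2; 0; 0];
  [:: 0; 2; -2; 0; 0; 0; 0; 0; 0; 0; 0; 0; 0; 0; 0; 0; 0; 0; 0; 0; 0; 0; 0; 0; 0; 0; 0; 0; 0; 0; 0; 0];
  [:: 0; 0; 2; 2; 0; 0; 0; 0; 0; 0; 0; 0; 0; 0; 0; 0; 0; 0; 0; 0; 0; 0; 0; 0; 0; 0; 0; 0; 0; 0; 0; 0];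
  [:: 0; 0; 0; 0; 0; 2; -2; 0; 0; 0; 0; 0; 0; 0; 0; 0; 0; 0; 0; 0; 0; 0; 0; 0; 0; 0; 0; 0; 0; 0; 0; 0];
  [:: 0; 0; 0; 0; 0; 0; 2; 2; 0; 0; 0; 0; 0; 0; 0; 0; 0; 0; 0; 0; 0; 0; 0; 0; 0; 0; 0; 0; 0; 0; 0; 0];
  [:: 0; 0; 0; 0; 0; 0; 0; 0; 0; 2; -2; 0; 0; 0; 0; 0; 0; 0; 0; 0; 0; 0; 0; 0; 0; 0; 0; 0; 0; 0; 0; 0];
  [:: 0; 0; 0; 0; 0; 0; 0; 0; 0; 0; 2; 2; 0; 0; 0; 0; 0; 0; 0; 0; 0; 0; 0; 0; 0; 0; 0; 0; 0; 0; 0; 0];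
  [:: 0; 0; 0; 0; 0; 0; 0; 0; 0; 0; 0; 0; 0; 2; -2; 0; 0; 0; 0; 0; 0; 0; 0; 0; 0; 0; 0; 0; 0; 0; 0; 0];
  [:: 0; 0; 0; 0; 0; 0; 0; 0; 0; 0; 0; 0; 0; 0; 2; 2; 0; 0; 0; 0; 0; 0; 0; 0; 0; 0; 0; 0; 0; 0; 0; 0];
  [:: 0; 0; 0; 0; 0; 0; 0; 0; 0; 0; 0; 0; 0; 0; 0; 0; 2; 0; 0; 0; 0; 0; 0; 0; 0; 0; 0; 0; 0; 0; 0; 0];
  [:: 0; 0; 0; 0; 0; 0; 0; 0; 0; 0; 0; 0; 0; 0; 0; 0; 0; 2; 2; 0; 0; 0; 0; 0; 0; 0; 0; 0; 0; 0; 0; 0];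
  [:: 0; 0; 0; 0; 0; 0; 0; 0; 0; 0; 0; 0; 0; 0; 0; 0; 0; 2; -2; 0; 0; 0; 0; 0; 0; 0; 0; 0; 0; 0; 0; 0];
  [:: 0; 0; 0; 0; 0; 0; 0; 0; 0; 0; 0; 0; 0; 0; 0; 0; 0; 0; 2; -2; 0; 0; 0; 0; 0; 0; 0; 0; 0; 0; 0; 0];
  [:: 0; 0; 0; 0; 0; 0; 0; 0; 0; 0; 0; 0; 0; 0; 0; 0; 0; 0; 0; 0; 2; 0; 0; 0; 0; 0; 0; 0; 0; 0; 0; 0];
  [:: 0; 0; 0; 0; 0; 0; 0; 0; 0; 0; 0; 0; 0; 0; 0; 0; 0; 0; 0; 0; 0; 2; 2; 0; 0; 0; 0; 0; 0; 0; 0; 0];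
  [:: 0; 0; 0; 0; 0; 0; 0; 0; 0; 0; 0; 0; 0; 0; 0; 0; 0; 0; 0; 0; 0; 2; -2; 0; 0; 0; 0; 0; 0; 0; 0; 0];
  [:: 0; 0; 0; 0; 0; 0; 0; 0; 0; 0; 0; 0; 0; 0; 0; 0; 0; 0; 0; 0; 0; 0; 2; -2; 0; 0; 0; 0; 0; 0; 0; 0];
  [:: 0; 0; 0; 0; 0; 0; 0; 0; 0; 0; 0; 0; 0; 0; 0; 0; 0; 0; 0; 0; 0; 0; 0; 0; 2; 0; 0; 0; 0; 0; 0; 0];
  [:: 0; 0; 0; 0; 0; 0; 0; 0; 0; 0; 0; 0; 0; 0; 0; 0; 0; 0; 0; 0; 0; 0; 0; 0; 0; 2; 2; 0; 0; 0; 0; 0];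
  [:: 0; 0; 0; 0; 0; 0; 0; 0; 0; 0; 0; 0; 0; 0; 0; 0; 0; 0; 0; 0; 0; 0; 0; 0; 0; 2; -2; 0; 0; 0; 0; 0];
  [:: 0; 0; 0; 0; 0; 0; 0; 0; 0; 0; 0; 0; 0; 0; 0; 0; 0; 0; 0; 0; 0; 0; 0; 0; 0; 0; 2; -2; 0; 0; 0; 0];
  [:: 0; 0; 0; 0; 0; 0; 0; 0; 0; 0; 0; 0; 0; 0; 0; 0; 0; 0; 0; 0; 0; 0; 0; 0; 0; 0; 0; 0; 2; 0; 0; 0];
  [:: 0; 0; 0; 0; 0; 0; 0; 0; 0; 0; 0; 0; 0; 0; 0; 0; 0; 0; 0; 0; 0; 0; 0; 0; 0; 0; 0; 0; 0; 2; 2; 0];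
  [:: 0; 0; 0; 0; 0; 0; 0; 0; 0; 0; 0; 0; 0; 0; 0; 0; 0; 0; 0; 0; 0; 0; 0; 0; 0; 0; 0; 0; 0; 2; -2; 0];
  [:: 0; 0; 0; 0; 0; 0; 0; 0; 0; 0; 0; 0; 0; 0; 0; 0; 0; 0; 0; 0; 0; 0; 0; 0; 0; 0; 0; 0; 0; 0; 2; -2]].
Definition gram_inv_rows : seq (seq int) := [::
  [:: 12; 0; 0; 0; 0; 0; 0; 0; -4; -8; 0; 0; 0; 0; 0; 0; -6; 0; 0; 0; 0; -9; 3; 6; 0; -9; 3; 6; -6; -9; 3; 6];
  [:: 0; 12; 0; 0; 0; 0; 0; 0; 0; 0; -4; -8; 0; 0; 0; 0; -6; -9; 3; 6; -6; 0; 0; 0; 0; -9; 3; 6; 0; -9; 3; 6];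
  [:: 0; 0; 12; 0; 0; 0; 0; 0; 0; 0; 0; 0; -4; -8; 0; 0; 0; -9; 3; 6; -6; 9; -3; -6; -6; 0; 0; 0; 0; -9; 3; 6];
  [:: 0; 0; 0; 12; 0; 0; 0; 0; 0; 0; 0; 0; 0; 0; -4; -8; 0; 9; -3; -6; 0; -9; 3; 6; -6; -9; 3; 6; -6; 0; 0; 0];
  [:: 0; 0; 0; 0; 2; 0; 0; 0; 0; 0; 0; 0; 0; 0; 0; 0; 0; -1; -1; 0; -1; -1; -1; 0; -1; 0; 0; 0; -1; 0; 0; 0];
  [:: 0; 0; 0; 0; 0; 2; 0; 0; 0; 0; 0; 0; 0; 0; 0; 0; -1; 0; 0; 0; 0; -1; -1; 0; -1; -1; -1; 0; -1; 0; 0; 0];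
  [:: 0; 0; 0; 0; 0; 0; 2; 0; 0; 0; 0; 0; 0; 0; 0; 0; -1; 0; 0; 0; -1; 0; 0; 0; 0; -1; -1; 0; -1; -1; -1; 0];
  [:: 0; 0; 0; 0; 0; 0; 0; 2; 0; 0; 0; 0; 0; 0; 0; 0; -1; -1; -1; 0; -1; 0; 0; 0; -1; 0; 0; 0; 0; -1; -1; 0];
  [:: -4; 0; 0; 0; 0; 0; 0; 0; 2; 3; 0; 0; 0; 0; 0; 0; 2; 0; 0; 0; 0; 3; -1; -2; 0; 3; -1; -2; 2; 3; -1; -2];
  [:: -8; 0; 0; 0; 0; 0; 0; 0; 3; 6; 0; 0; 0; 0; 0; 0; 4; 0; 0; 0; 0; 6; -2; -4; 0; 6; -2; -4; 4; 6; -2; -4];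
  [:: 0; -4; 0; 0; 0; 0; 0; 0; 0; 0; 2; 3; 0; 0; 0; 0; 2; 3; -1; -2; 2; 0; 0; 0; 0; 3; -1; -2; 0; 3; -1; -2];
  [:: 0; -8; 0; 0; 0; 0; 0; 0; 0; 0; 3; 6; 0; 0; 0; 0; 4; 6; -2; -4; 4; 0; 0; 0; 0; 6; -2; -4; 0; 6; -2; -4];
  [:: 0; 0; -4; 0; 0; 0; 0; 0; 0; 0; 0; 0; 2; 3; 0; 0; 0; 3; -1; -2; 2; -3; 1; 2; 2; 0; 0; 0; 0; 3; -1; -2];
  [:: 0; 0; -8; 0; 0; 0; 0; 0; 0; 0; 0; 0; 3; 6; 0; 0; 0; 6; -2; -4; 4; -6; 2; 4; 4; 0; 0; 0; 0; 6; -2; -4];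
  [:: 0; 0; 0; -4; 0; 0; 0; 0; 0; 0; 0; 0; 0; 0; 2; 3; 0; -3; 1; 2; 0; 3; -1; -2; 2; 3; -1; -2; 2; 0; 0; 0];
  [:: 0; 0; 0; -8; 0; 0; 0; 0; 0; 0; 0; 0; 0; 0; 3; 6; 0; -6; 2; 4; 0; 6; -2; -4; 4; 6; -2; -4; 4; 0; 0; 0];
  [:: -6; -6; 0; 0; 0; -1; -1; -1; 2; 4; 2; 4; 0; 0; 0; 0; 8; 5; -1; -3; 4; 5; -1; -3; 1; 10; -2; -6; 4; 10; -2; -6];
  [:: 0; -9; -9; 9; -1; 0; 0; -1; 0; 0; 3; 6; 3; 6; -3; -6; 5; 22; -6; -14; 10; -13; 5; 9; 1; 0; 0; 0; -4; 14; -4; -9];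
  [:: 0; 3; 3; -3; -1; 0; 0; -1; 0; 0; -1; -2; -1; -2; 1; 2; -1; -6; 4; 5; -2; 5; -1; -3; 1; 0; 0; 0; 2; -4; 2; 3];
  [:: 0; 6; 6; -6; 0; 0; 0; 0; 0; 0; -2; -4; -2; -4; 2; 4; -3; -14; 5; 10; -6; 9; -3; -6; 0; 0; 0; 0; 3; -9; 3; 6];
  [:: 0; -6; -6; 0; -1; 0; -1; -1; 0; 0; 2; 4; 2; 4; 0; 0; 4; 10; -2; -6; 8; -4; 2; 3; 4; 5; -1; -3; 1; 10; -2; -6];
  [:: -9; 0; 9; -9; -1; -1; 0; 0; 3; 6; 0; 0; -3; -6; 3; 6; 5; -13; 5; 9; -4; 22; -6; -14; 1; 14; -4; -9; 10; 0; 0; 0];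
  [:: 3; 0; -3; 3; -1; -1; 0; 0; -1; -2; 0; 0; 1; 2; -1; -2; -1; 5; -1; -3; 2; -6; 4; 5; 1; -4; 2; 3; -2; 0; 0; 0];
  [:: 6; 0; -6; 6; 0; 0; 0; 0; -2; -4; 0; 0; 2; 4; -2; -4; -3; 9; -3; -6; 3; -14; 5; 10; 0; -9; 3; 6; -6; 0; 0; 0];
  [:: 0; 0; -6; -6; -1; -1; 0; -1; 0; 0; 0; 0; 2; 4; 2; 4; 1; 1; 1; 0; 4; 1; 1; 0; 8; 5; -1; -3; 4; 5; -1; -3];
  [:: -9; -9; 0; -9; 0; -1; -1; 0; 3; 6; 3; 6; 0; 0; 3; 6; 10; 0; 0; 0; 5; 14; -4; -9; 5; 22; -6; -14; 10; 14; -4; -9];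
  [:: 3; 3; 0; 3; 0; -1; -1; 0; -1; -2; -1; -2; 0; 0; -1; -2; -2; 0; 0; 0; -1; -4; 2; 3; -1; -6; 4; 5; -2; -4; 2; 3];
  [:: 6; 6; 0; 6; 0; 0; 0; 0; -2; -4; -2; -4; 0; 0; -2; -4; -6; 0; 0; 0; -3; -9; 3; 6; -3; -14; 5; 10; -6; -9; 3; 6];
  [:: -6; 0; 0; -6; -1; -1; -1; 0; 2; 4; 0; 0; 0; 0; 2; 4; 4; -4; 2; 3; 1; 10; -2; -6; 4; 10; -2; -6; 8; 5; -1; -3];
  [:: -9; -9; -9; 0; 0; 0; -1; -1; 3; 6; 3; 6; 3; 6; 0; 0; 10; 14; -4; -9; 10; 0; 0; 0; 5; 14; -4; -9; 5; 22; -6; -14];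
  [:: 3; 3; 3; 0; 0; 0; -1; -1; -1; -2; -1; -2; -1; -2; 0; 0; -2; -4; 2; 3; -2; 0; 0; 0; -1; -4; 2; 3; -1; -6; 4; 5];
  [:: 6; 6; 6; 0; 0; 0; 0; 0; -2; -4; -2; -4; -2; -4; 0; 0; -6; -9; 3; 6; -6; 0; 0; 0; -3; -9; 3; 6; -3; -14; 5; 10]].

(** Sums and bounded quantifiers are given in a form that evaluates, so that the finite checks below
    can be run by the virtual machine. *)
Fixpoint isum (n : nat) (f : nat -> int) : int :=
  if n is m.+1 then isum m f + f m else 0.

Lemma isumE n f : isum n f = \sum_(i < n) f i.
Proof. by elim: n => [|n IH] /=; rewrite ?big_ord0 ?big_ord_recr ?IH. Qed.

Definition all_below n (p : pred nat) := all p (iota 0 n).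

Lemma all_belowP n (p : pred nat) :
  reflect (forall i, (i < n)%N -> p i) (all_below n p).
Proof.
apply: (iffP allP) => h i; first by move=> ni; apply: h; rewrite mem_iota.
by rewrite mem_iota => /andP[_]; apply: h.
Qed.

(** Four times the squared scale of coordinate [k]. Thus [wdot] is four times the inner product, and
    norm 2 becomes [wdot z z = 8]. *)
Definition weight (k : nat) : int := if (k %% 4)%N is 0%N then 2 else 1.

Definition basis (i k : nat) : int := nth 0 (nth [::] basis_rows i) k.

Definition gram_inv (i j : nat) : int := nth 0 (nth [::] gram_inv_rows i) j.

Definition wdot (y z : nat -> int) : int :=
  isum 32 (fun k => weight k * y k * z k).

Definition gram_rows : seq (seq int) :=
  mkseq (fun i => mkseq (fun j => (wdot (basis i) (basis j) %/ 4)%Z) 32) 32.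

Definition gram (i j : nat) : int := nth 0 (nth [::] gram_rows i) j.

Lemma gram_spec :
  all_below 32 (fun i => all_below 32 (fun j =>
    wdot (basis i) (basis j) == 4 * gram i j)).
Proof. by vm_cast_no_check (erefl true). Qed.

Lemma gram_even : all_below 32 (fun i => (2 %| gram i i)%Z).
Proof. by vm_cast_no_check (erefl true). Qed.

Lemma gram_invE :
  let G := gram_rows in
  all_below 32 (fun i => all_below 32 (fun j =>
    isum 32 (fun k => nth 0 (nth [::] G i) k * gram_inv k j) == (i == j)%:R)).
Proof. by vm_cast_no_check (erefl true). Qed.

(* A block [(u, v)] of four coordinates has glue class [u] modulo 2 in A1*/A1
   and [v1 + v2 + v3] modulo 4 in D3*/D3; [u] is doubled so that both are read
   modulo 4. *)
Definition glue_class (z : nat -> int) (j : nat) : int :=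
  let b := (4 * j./2)%N in
  if odd j then z b.+1 + z b.+2 + z b.+3 else 2 * z b.

(* Minimum of [2 u ^ 2] resp. of [v1 ^ 2 + v2 ^ 2 + v3 ^ 2] over a class. *)
Definition class_wt (j : nat) (t : int) : nat :=
  nth 0%N (if odd j then [:: 0; 3; 4; 3] else [:: 0; 0; 2; 0])%N `|(t %% 4)%Z|.

(** The class weights add up to a lower bound of [wdot z z] on the class, so a total above 8
    excludes vectors of norm 2. *)
Definition heavy_or_trivial (t : nat -> int) : bool :=
  all_below 16 (fun j => (4 %| t j)%Z) ||
  (8 < sumn (mkseq (fun j => class_wt j (t j)) 16))%N.

(** Search through all combinations with coefficient [0 <= k < m] for each pair [(m, g)]. For
    [glue_gens] there are 4^4 * 2^4 = 2^12 of them. *)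
Fixpoint combinations_ok (gs : seq (nat * seq int)) (acc : seq int) : bool :=
  if gs is (m, g) :: gs' then
    all_below m (fun k => combinations_ok gs'
      (mkseq (fun j => nth 0 acc j + k%:Z * nth 0 g j) 16))
  else heavy_or_trivial (nth 0 acc).

Definition glue_order (i : nat) : nat := if (i < 4)%N then 4 else 2.

Definition glue_gens : seq (nat * seq int) :=
  mkseq (fun i => (glue_order i, mkseq (glue_class (basis i)) 16)) 8.

Lemma glue_code_min : combinations_ok glue_gens (nseq 16 0).
Proof. by vm_cast_no_check (erefl true). Qed.

Lemma glue_gens_order : all_below 8 (fun i => all_below 16 (fun j =>
  (4 %| (glue_order i)%:Z * glue_class (basis i) j)%Z)).
Proof. by vm_cast_no_check (erefl true). Qed.

Lemma basis_roots_class : all_below 32 (fun i => (i < 8)%N ||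
  all_below 16 (fun j => (4 %| glue_class (basis i) j)%Z)).
Proof. by vm_cast_no_check (erefl true). Qed.

(** In half units, the vectors of D3* are the triples that are all even or all odd. The glue class,
    being a sum, does not record this. *)
Definition same_parity (z : nat -> int) : bool := all_below 8 (fun b =>
  (2 %| z (4 * b).+1 - z (4 * b).+2)%Z && (2 %| z (4 * b).+1 - z (4 * b).+3)%Z).

Lemma basis_parity : all_below 32 (fun i => same_parity (basis i)).
Proof. by vm_cast_no_check (erefl true). Qed.

(* The roots of a component are the differences of two vectors of its frame,
   the image of [e_i - e_j] being the difference of the frame vectors i and j. *)
Definition A1_frame : seq (seq int) := [:: [:: 1; 0; 0; 0]; [:: -1; 0; 0; 0]].

(** The vertices of a regular tetrahedron. Their halved differences are the vectors with two entries
    1 or -1 and one entry 0, which identifies A3 with D3. *)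
Definition A3_frame : seq (seq int) :=
  [:: [:: 0; 1; 1; 1]; [:: 0; 1; -1; -1]; [:: 0; -1; 1; -1]; [:: 0; -1; -1; 1]].

Definition frame_rank (i : nat) : nat := nth 0%N (nseq 8 1%N ++ nseq 8 3%N) i.

Definition frame (i p k : nat) : int :=
  if (k %/ 4 == i %% 8)%N then
    nth 0 (nth [::] (if (i < 8)%N then A1_frame else A3_frame) p) (k %% 4)
  else 0.

(** Up to the factor 4, a frame has the inner products of the projections of the [e_p] orthogonally
    to the all-one vector. The constant [4 / (m + 1)] cancels in differences. *)
Lemma frame_wdot : all_below 16 (fun i => all_below 16 (fun j =>
  all_below (frame_rank i).+1 (fun p => all_below (frame_rank j).+1 (fun q =>
    wdot (frame i p) (frame j q) ==
      if i == j then (p == q)%:R * 4 - (4 %/ (frame_rank i).+1)%N%:Z else 0)))).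
Proof. by vm_cast_no_check (erefl true). Qed.

(** A congruence modulo 4 is the right condition, as only the differences of frame vectors are to
    pair integrally with the lattice. *)
Lemma frame_dual : all_below 16 (fun i => all_below (frame_rank i).+1 (fun p =>
  all_below 32 (fun l =>
    (4 %| wdot (frame i p) (basis l) - wdot (frame i 0) (basis l))%Z))).
Proof. by vm_cast_no_check (erefl true). Qed.

(** * Reduction of lattice vectors to the finite glue code *)

Lemma heavy_or_trivial_mod (t t' : nat -> int) :
  (forall j, (j < 16)%N -> (t j = t' j %[mod 4])%Z) ->
  heavy_or_trivial t -> heavy_or_trivial t'.
Proof.
move=> tt'; rewrite /heavy_or_trivial => /orP[/all_belowP h|h]; apply/orP.
  left; apply/all_belowP => j j16; apply/dvdz_mod0P.
  by rewrite -tt'//; apply/dvdz_mod0P/h.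
right; suff <- : mkseq (fun j => class_wt j (t j)) 16 =
                 mkseq (fun j => class_wt j (t' j)) 16 by [].
apply/eq_in_map => j; rewrite mem_iota => /andP[_ j16].
by rewrite /class_wt tt'.
Qed.

Lemma combinations_okP gs acc (k : nat -> nat) :
  combinations_ok gs acc ->
  (forall i, (i < size gs)%N -> (k i < (nth (0, [::]) gs i).1)%N) ->
  heavy_or_trivial (fun j => nth 0 acc j +
    \sum_(i < size gs) (k i)%:Z * nth 0 (nth (0, [::]) gs i).2 j).
Proof.
elim: gs acc k => [|[m g] gs IH] acc k /= ok hk.
  by apply: heavy_or_trivial_mod ok => j _; rewrite big_ord0 addr0.
have /all_belowP /(_ _ (hk 0 isT)) /IH := ok.
move=> /(_ (fun i => k i.+1) (fun i hi => hk i.+1 hi)).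
apply: heavy_or_trivial_mod => j j16.
by rewrite big_ord_recl/= nth_mkseq// addrA.
Qed.

Lemma glue_class_sum (c : nat -> int) (f : nat -> nat -> int) n j :
  glue_class (fun k => \sum_(i < n) c i * f i k) j =
  \sum_(i < n) c i * glue_class (f i) j.
Proof.
rewrite /glue_class; case: ifP => _.
  by rewrite -!big_split; apply: eq_bigr => i _; rewrite !mulrDr.
by rewrite mulr_sumr; apply: eq_bigr => i _; rewrite mulrCA.
Qed.

(** Coefficients of glue vectors may be reduced modulo [glue_order], and the remaining basis vectors
    have trivial class, so only the combinations already searched occur. *)
Lemma span_heavy_or_trivial (c : nat -> int) :
  heavy_or_trivial (glue_class (fun k => \sum_(i < 32) c i * basis i k)).
Proof.
pose k i := `|(c i %% glue_order i)%Z|%N.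
have ord0 i : (glue_order i)%:Z != 0 by rewrite /glue_order; case: ifP.
have kE i : (k i)%:Z = (c i %% glue_order i)%Z by rewrite gez0_abs ?modz_ge0.
have := @combinations_okP glue_gens (nseq 16 0) k glue_code_min.
have -> : (size glue_gens = 8)%N by [].
move=> /(_ _)/wrap[i i8|].
  rewrite nth_mkseq//= -ltz_nat kE ltz_pmod//.
  by rewrite /glue_order; case: ifP.
apply: heavy_or_trivial_mod => j j16.
rewrite nth_nseq j16 add0r glue_class_sum; apply/eqP; rewrite eqz_mod_dvd.
rewrite -(big_mkord xpredT (fun i => c i * glue_class (basis i) j)).
(* Separate the eight glue vectors from the 24 roots. *)
rewrite (big_cat_nat _ (n := 8))//= [X in _ - (_ + X)]big_nat opprD addrA.
apply: rpredB; last first.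
  apply: rpred_sum => i /andP[i8 i32]; apply/dvdz_mull.
  have /all_belowP/(_ _ i32) := basis_roots_class.
  by rewrite ltnNge i8/= => /all_belowP; apply.
rewrite big_mkord -sumrB; apply: rpred_sum => i _.
rewrite nth_mkseq//= nth_mkseq// -mulrBl kE.
have -> : (c i %% glue_order i)%Z - c i = - (c i %/ glue_order i)%Z * glue_order i.
  by rewrite {2}(divz_eq (c i) (glue_order i)); ring.
rewrite -mulrA; apply: dvdz_mull.
by have /all_belowP/(_ _ (ltn_ord i))/all_belowP := glue_gens_order; apply.
Qed.

(** * Vectors of norm 2 in integer coordinates *)

Lemma dvdz_witness (d m : int) : (d %| m)%Z -> exists q : int, m = q * d.
Proof. by move=> /dvdzP[q ->]; exists q. Qed.

Definition block_wdot (y z : nat -> int) (b : nat) : int :=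
  let k := (4 * b)%N in
  2 * (y k * z k) + y k.+1 * z k.+1 + y k.+2 * z k.+2 + y k.+3 * z k.+3.

Lemma wdot_blocks y z : wdot y z = \sum_(b < 8) block_wdot y z b.
Proof.
rewrite !big_ord_recr big_ord0 /= /block_wdot /wdot /isum /weight /=.
by rewrite !mul1r !addrA !mulrA.
Qed.

Lemma sum_class_wt t : sumn (mkseq (fun j => class_wt j (t j)) 16) =
  (\sum_(b < 8)
    (class_wt (2 * b) (t (2 * b)) + class_wt (2 * b).+1 (t (2 * b).+1)))%N.
Proof. by rewrite !big_ord_recr big_ord0 /= !addnA !addn0. Qed.

(** No weight in the A1 table exceeds 2, and a nonzero [u] already has [2 u^2 >= 2]. *)
Lemma class_wt_A1 b (u : int) : (class_wt (2 * b) (2 * u))%:Z <= 2 * (u * u).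
Proof.
rewrite /class_wt oddM /=; have [->//|u0] := eqVneq u 0.
have : (`|(2 * u %% 4)%Z| < 4)%N.
  have := modz_ge0 (2 * u) (isT : 4%:Z != 0).
  by have := ltz_pmod (2 * u) (isT : 0 < 4%:Z); lia.
have u1 : 2 <= 2 * (u * u) by nia.
by case: `|_|%N => [|[|[|[|]]]] //= _; apply: le_trans u1.
Qed.

(** By equal parities, an odd class has three odd entries, each of square at least 1. Class 2 has
    three even entries that are not all zero, one of which has square at least 4. *)
Lemma class_wt_A3 b (x y z : int) : (2 %| x - y)%Z -> (2 %| x - z)%Z ->
  (class_wt (2 * b).+1 (x + y + z))%:Z <= x * x + y * y + z * z.
Proof.
move=> /dvdz_witness[q hq] /dvdz_witness[r hr]; rewrite /class_wt /= oddM /=.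
have sq0 (t : int) : 0 <= t * t by rewrite -expr2 sqr_ge0.
have sq1 (t : int) : t != 0 -> 1 <= t * t by nia.
have sq4 (t w : int) : t = 2 * w -> t = 0 \/ 4 <= t * t.
  by move=> ->; have [->|/sq1] := eqVneq w 0; [left|right; lia].
have s4 := divz_eq (x + y + z) 4.
have := modz_ge0 (x + y + z) (isT : 4%:Z != 0).
have := ltz_pmod (x + y + z) (isT : 0 < 4%:Z).
move: (_ %% 4)%Z (_ %/ 4)%Z s4 => m d s4 m4 m0.
have [->|[m2|modd]] : m = 0 \/ m = 2 \/ m = 1 \/ m = 3 by lia.
- by rewrite /= !addr_ge0.
(* The witness comes from [3 x - 2 q - 2 r = 4 d + 2] by isolating one [x]. *)
- have [w xw] : exists w, x = 2 * w by exists (2 * d + 1 - x + q + r); lia.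
  have yw : y = 2 * (w - q) by lia.
  have zw : z = 2 * (w - r) by lia.
  have := (sq0 x, sq0 y, sq0 z); rewrite m2/= => -[[? ?] ?].
  by case: (sq4 x _ xw) (sq4 y _ yw) (sq4 z _ zw) => ? [] ? [] ?; lia.
- have x1 : x != 0 by lia.
  have y1 : y != 0 by lia.
  have z1 : z != 0 by lia.
  have := (sq1 x x1, sq1 y y1, sq1 z z1) => -[[? ?] ?].
  by case: modd => -> /=; lia.
Qed.

(** The heavy alternative would force [wdot z z > 8]. So every class is trivial and [z] lies in the
    root lattice, where each block has even norm, that is, [block_wdot] divisible by 8. *)
Lemma norm8_blocks z : same_parity z -> heavy_or_trivial (glue_class z) ->
  wdot z z = 8 -> forall b, (b < 8)%N ->
  [/\ (2 %| z (4 * b)%N)%Z, (2 %| z (4 * b).+1)%Z, (2 %| z (4 * b).+2)%Z,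
      (2 %| z (4 * b).+3)%Z & (8 %| block_wdot z z b)%Z].
Proof.
move=> /all_belowP par hot z8 b b8.
have half2 n : ((2 * n)./2 = n)%N by rewrite mul2n doubleK.
have uphalf2 n : (uphalf (2 * n) = n)%N by rewrite mul2n uphalf_double.
have {hot} /all_belowP cl : all_below 16 (fun j => (4 %| glue_class z j)%Z).
  move: hot => /orP[//|]; rewrite sum_class_wt ltnNge => /negP[].
  rewrite -lez_nat (_ : 8%:Z = wdot z z); last by rewrite z8.
  rewrite wdot_blocks (big_morph Posz PoszD (erefl _)) ler_sum//.
  move=> {b8}b _; rewrite PoszD /block_wdot -!addrA; apply: lerD.
    by rewrite /glue_class oddM/= half2; apply: class_wt_A1.
  rewrite /glue_class/= oddM/= uphalf2 addrA.
  by have /andP[? ?] := par b (ltn_ord b); apply: class_wt_A3.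
have b16 : (2 * b < 16)%N /\ ((2 * b).+1 < 16)%N by lia.
have := cl _ b16.1; have := cl _ b16.2; have := par _ b8.
rewrite /glue_class/= oddM/= uphalf2 half2 /block_wdot.
move=> /andP[/dvdz_witness[q hq] /dvdz_witness[r hr]].
move=> /dvdz_witness[s hs] /dvdz_witness[t ht].
move: (z _) (z _) (z _) (z _) hq hr hs ht => u v3 v2 v1 hq hr hs ht.
have [w v1w] : exists w, v1 = 2 * w by exists (2 * s - v1 + q + r); lia.
have [a v2a] : exists a, v2 = 2 * a by exists (w - q); lia.
have -> : u = 2 * t by lia.
have v3E : v3 = 2 * (2 * s - w - a) by lia.
rewrite {}v3E {}v2a {}v1w in hq hr hs *.
split; try exact: dvdz_mulr.
(* With [c = 2 s - w - a] one has [w + a + c = 2 s], so [w^2 + a^2 + c^2] is [4 s^2] minus twice the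
   second elementary symmetric function of [w], [a], [c]. *)
apply/dvdzP; exists (t * t + 2 * s * s - w * a - (w + a) * (2 * s - w - a)).
by ring.
Qed.

Lemma sum_multiples8 n (f : nat -> int) :
  (forall b, (b < n)%N -> 0 <= f b /\ (8 %| f b)%Z) -> \sum_(b < n) f b = 8 ->
  exists b, [/\ (b < n)%N, f b = 8 &
    forall b', (b' < n)%N -> b' != b -> f b' = 0].
Proof.
move=> hf s8.
have [b fb] : exists b : 'I_n, f b != 0.
  apply/existsP; apply: contraT; rewrite negb_exists => /forallP f0.
  by move: s8; rewrite big1// => i _; apply/eqP; rewrite -[_ == _]negbK.
have rest0 : 0 <= \sum_(i < n | i != b) f i.
  by apply: sumr_ge0 => i _; case: (hf i (ltn_ord i)).
have [fb0 /dvdz_witness[q fbq]] := hf b (ltn_ord b).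
move: s8; rewrite (bigD1 b)//= => s8.
have [fb8 /eqP rest_eq0] : f b = 8 /\ \sum_(i < n | i != b) f i = 0.
  move: (\sum_(_ | _) _) rest0 s8 => S S0 s8; move/eqP: fb => fb.
  have : (q = 0 \/ 1 <= q)%R by lia.
  by lia.
move: rest_eq0; rewrite psumr_eq0 => [/allP rest_eq0|i _]; last first.
  by case: (hf i (ltn_ord i)).
exists b; split=> // b' b'n b'b.
have := rest_eq0 (Ordinal b'n) (mem_index_enum _).
by rewrite -val_eqE/= b'b => /eqP.
Qed.

(** Block contributions are non-negative multiples of 8 with sum 8, so a single block carries [z].
    Halving its coordinates leaves [2 u^2 + v1^2 + v2^2 + v3^2 = 2]. *)
Lemma norm8_frame z : same_parity z -> heavy_or_trivial (glue_class z) ->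
  wdot z z = 8 ->
  exists i p q, [/\ (i < 16)%N, (p < (frame_rank i).+1)%N,
    (q < (frame_rank i).+1)%N, p != q
    & forall k, (k < 32)%N -> z k = frame i p k - frame i q k].
Proof.
move=> par hot z8; have blocks := norm8_blocks par hot z8.
have sq0 (t : int) : 0 <= t * t by rewrite -expr2 sqr_ge0.
have [||b [b8 zb zb']] := @sum_multiples8 8 (block_wdot z z).
- move=> b b8; have [_ _ _ _ ?] := blocks b b8; split=> //.
  by rewrite /block_wdot; have := (sq0 (z (4 * b)%N), sq0 (z (4 * b).+1),
    sq0 (z (4 * b).+2), sq0 (z (4 * b).+3)) => -[[[? ?] ?] ?]; lia.
- by rewrite -wdot_blocks.
have out b' r : (b' < 8)%N -> b' != b -> (r < 4)%N -> z (4 * b' + r)%N = 0.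
  move=> b'8 b'b; have := zb' _ b'8 b'b; rewrite /block_wdot => h r4.
  have := (sq0 (z (4 * b')%N), sq0 (z (4 * b').+1), sq0 (z (4 * b').+2),
           sq0 (z (4 * b').+3)) => -[[[h0 h1] h2] h3].
  apply/eqP; rewrite -[_ == 0]orbb -mulf_eq0; apply/eqP.
  by case: r r4 => [|[|[|[|]]]]// _; rewrite ?addn0 ?addn1 ?addn2 ?addn3; lia.
have inside i p q : (i < 16)%N -> (i %% 8)%N = b ->
    (forall r, (r < 4)%N -> z (4 * b + r)%N =
       frame i p (4 * b + r) - frame i q (4 * b + r)) ->
    forall k, (k < 32)%N -> z k = frame i p k - frame i q k.
  move=> i16 ib h k k32; have kE : (4 * (k %/ 4) + k %% 4 = k)%N.
    by rewrite mulnC -divn_eq.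
  have [kb|kb] := eqVneq (k %/ 4)%N b.
    by have := h (k %% 4)%N; rewrite -kb kE; apply; rewrite ltn_mod.
  by rewrite /frame ib (negbTE kb) subrr -kE out ?ltn_mod ?ltn_divLR.
have frameE i p r : (i %% 8)%N = b -> (r < 4)%N -> frame i p (4 * b + r) =
    nth 0 (nth [::] (if (i < 8)%N then A1_frame else A3_frame) p) r.
  move=> ib r4; rewrite /frame mulnC divnMDl// divn_small// addn0 ib eqxx.
  by rewrite modnMDl modn_small.
have [/dvdz_witness[u hu] /dvdz_witness[v1 h1] /dvdz_witness[v2 h2]
  /dvdz_witness[v3 h3] _] := blocks b b8.
have {zb} norm2 : 2 * (u * u) + v1 * v1 + v2 * v2 + v3 * v3 = 2.
  by move: zb; rewrite /block_wdot hu h1 h2 h3; lia.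
have small (t : int) : t * t <= 2 -> t = 0 \/ t = 1 \/ t = -1.
  move=> t2; have [? ?] : -2 < t /\ t < 2 by nia.
  lia.
have b16 : (b < 16)%N /\ (b + 8 < 16)%N by lia.
have bmod : (b %% 8 = b)%N /\ ((b + 8) %% 8 = b)%N.
  by rewrite modnDr modn_small.
have frame_rankE : frame_rank b = 1%N /\ frame_rank (b + 8) = 3%N.
  by move: b8; clear; do 8 (case: b => [|b]//).
pose of_frame (F : seq (seq int)) p q := forall r, (r < 4)%N ->
  z (4 * b + r)%N = nth 0 (nth [::] F p) r - nth 0 (nth [::] F q) r.
pose goal := exists i p q, [/\ (i < 16)%N, (p < (frame_rank i).+1)%N,
  (q < (frame_rank i).+1)%N, p != q & forall k, (k < 32)%N ->
  z k = frame i p k - frame i q k].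
have A1 p q : (p < 2)%N -> (q < 2)%N -> p != q -> of_frame A1_frame p q -> goal.
  move=> p2 q2 pq h; exists b, p, q; rewrite frame_rankE.1; split=> //.
    exact: b16.1.
  apply: (inside b p q b16.1 bmod.1) => r r4.
  by rewrite !frameE ?bmod.1// b8 h.
have A3 p q : (p < 4)%N -> (q < 4)%N -> p != q -> of_frame A3_frame p q -> goal.
  move=> p4 q4 pq h; exists (b + 8)%N, p, q; rewrite frame_rankE.2; split=> //.
    exact: b16.2.
  apply: (inside _ p q b16.2 bmod.2) => r r4.
  by rewrite !frameE ?bmod.2// ltnNge leq_addl h.
have zE r : (r < 4)%N ->
    z (4 * b + r)%N = nth 0 [:: u * 2; v1 * 2; v2 * 2; v3 * 2] r.
  by case: r => [|[|[|[|]]]]// _; rewrite /= ?addn0 ?addn1 ?addn2 ?addn3.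
have := (sq0 u, sq0 v1, sq0 v2, sq0 v3) => -[[[u0 v10] v20] v30].
have u2 : u * u <= 2 by lia.
have v12 : v1 * v1 <= 2 by lia.
have v22 : v2 * v2 <= 2 by lia.
have v32 : v3 * v3 <= 2 by lia.
(* Of the 81 sign patterns, [norm2] refutes all but 14: the twelve roots of A3 and the two of A1. *)
case: (small _ u2) (small _ v12) (small _ v22) (small _ v32)
  => [uE|[uE|uE]] [v1E|[v1E|v1E]] [v2E|[v2E|v2E]] [v3E|[v3E|v3E]];
  rewrite uE v1E v2E v3E in norm2 zE; try by [].
- by apply: (A3 0 1)%N => // r r4; rewrite zE//; case: r r4 => [|[|[|[]]]].
- by apply: (A3 2 3)%N => // r r4; rewrite zE//; case: r r4 => [|[|[|[]]]].
- by apply: (A3 3 2)%N => // r r4; rewrite zE//; case: r r4 => [|[|[|[]]]].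
- by apply: (A3 1 0)%N => // r r4; rewrite zE//; case: r r4 => [|[|[|[]]]].
- by apply: (A3 0 2)%N => // r r4; rewrite zE//; case: r r4 => [|[|[|[]]]].
- by apply: (A3 1 3)%N => // r r4; rewrite zE//; case: r r4 => [|[|[|[]]]].
- by apply: (A3 0 3)%N => // r r4; rewrite zE//; case: r r4 => [|[|[|[]]]].
- by apply: (A3 1 2)%N => // r r4; rewrite zE//; case: r r4 => [|[|[|[]]]].
- by apply: (A3 3 1)%N => // r r4; rewrite zE//; case: r r4 => [|[|[|[]]]].
- by apply: (A3 2 0)%N => // r r4; rewrite zE//; case: r r4 => [|[|[|[]]]].
- by apply: (A3 2 1)%N => // r r4; rewrite zE//; case: r r4 => [|[|[|[]]]].
- by apply: (A3 3 0)%N => // r r4; rewrite zE//; case: r r4 => [|[|[|[]]]].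
- by apply: (A1 0 1)%N => // r r4; rewrite zE//; case: r r4 => [|[|[|[]]]].
- by apply: (A1 1 0)%N => // r r4; rewrite zE//; case: r r4 => [|[|[|[]]]].
Qed.

(** * The lattice *)

Section Lattice.
Context {R : realType}.

Definition scale (k : nat) : R :=
  if (k %% 4)%N is 0%N then Num.sqrt 2 / 2 else 2^-1.

Lemma sqr_scale k : scale k * scale k = (weight k)%:~R / 4.
Proof.
rewrite /scale /weight; case: (k %% 4)%N => [|_]; last by field.
by rewrite mulrACA -expr2 sqr_sqrtr//; field.
Qed.

Definition embed (z : nat -> int) : 'cV[R]_32 := \col_k (scale k * (z k)%:~R).

Lemma dot_embed y z : dot (embed y) (embed z) = (wdot y z)%:~R / 4.
Proof.
rewrite dotE /wdot isumE rmorph_sum mulr_suml; apply: eq_bigr => k _.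
by rewrite !mxE !rmorphM/= mulrACA sqr_scale; ring.
Qed.

Lemma wdotBl y y' z : wdot (fun k => y k - y' k) z = wdot y z - wdot y' z.
Proof. by rewrite /wdot !isumE -sumrB; apply: eq_bigr => k _; ring. Qed.

Lemma wdotC y z : wdot y z = wdot z y.
Proof. by rewrite /wdot !isumE; apply: eq_bigr => k _; rewrite mulrAC. Qed.

Definition Bmx : 'M[R]_32 := \matrix_(k, i) (scale k * (basis i k)%:~R).

Definition L32 : set 'cV[R]_32 := int_span Bmx.

Definition Gmx : 'M[int]_32 := \matrix_(i, j) gram i j.

Lemma col_Bmx i : col i Bmx = embed (basis i).
Proof. by apply/matrixP => k j; rewrite !mxE. Qed.

Lemma Bmx_gram : Bmx^T *m Bmx = map_mx intr Gmx.
Proof.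
apply/matrixP => i j; rewrite !mxE.
have -> : (gram i j)%:~R = dot (embed (basis i)) (embed (basis j)) :> R.
  rewrite dot_embed.
  have /all_belowP/(_ _ (ltn_ord i))/all_belowP/(_ _ (ltn_ord j)) := gram_spec.
  by move/eqP->; rewrite rmorphM/=; field.
by rewrite dotE; apply: eq_bigr => k _; rewrite !mxE.
Qed.

Lemma Gmx_inv : Gmx *m (\matrix_(i, j) gram_inv i j) = 1%:M.
Proof.
apply/matrixP => i j; rewrite !mxE.
have /all_belowP/(_ _ (ltn_ord i))/all_belowP/(_ _ (ltn_ord j)) := gram_invE.
rewrite isumE => /eqP; rewrite -val_eqE/= => <-.
by apply: eq_bigr => k _; rewrite !mxE.
Qed.

Lemma L32_lattice : is_lattice L32.
Proof. exact: int_span_lattice Bmx_gram Gmx_inv. Qed.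

Lemma L32_unimodular : unimodular L32.
Proof. exact: int_span_unimodular Bmx_gram Gmx_inv. Qed.

Lemma L32_even : even_lattice L32.
Proof.
apply: int_span_even Bmx_gram _ => i; rewrite mxE.
have /all_belowP/(_ _ (ltn_ord i))/dvdz_witness[k ->] := gram_even.
by exists k; rewrite mulrC.
Qed.

Lemma dotxx_L32_ge4 x : L32 x -> x != 0 -> dot x x != 2 -> 4 <= dot x x.
Proof.
move=> Lx x0 x2; have := dotxx_ge0 x; move: x2; rewrite -dotxx_eq0 in x0.
have [k hk] := L32_even Lx; move: x0; rewrite hk.
rewrite (_ : 2 = (2 : int)%:~R :> R) // (_ : 4 = (4 : int)%:~R :> R)//.
by rewrite eqr_int intr_eq0 ler0z ler_int; lia.
Qed.

Lemma L32_coords x : L32 x -> exists z,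
  [/\ x = embed z, same_parity z & heavy_or_trivial (glue_class z)].
Proof.
move=> [c ->]; pose c' i := c (inord i) 0.
exists (fun k => \sum_(i < 32) c' i * basis i k); split.
- apply/matrixP => k j; rewrite !mxE (ord1 j) rmorph_sum mulr_sumr.
  apply: eq_bigr => i _; rewrite !mxE /c' inord_val rmorphM/=.
  by rewrite mulrCA mulrC.
- apply/all_belowP => b b8; rewrite -!sumrB.
  have par := elimT (all_belowP _ _) basis_parity.
  by apply/andP; split; apply: rpred_sum => i _; rewrite -mulrBr;
    apply: dvdz_mull;
    have /all_belowP/(_ _ b8)/andP[] := par _ (ltn_ord i).
- exact: span_heavy_or_trivial.
Qed.

Definition frame_root (i p q : nat) : 'cV[R]_32 :=
  embed (fun k => frame i p k - frame i q k).

Lemma norm2_L32_root x : L32 x -> dot x x = 2 -> exists i p q,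
  [/\ (i < 16)%N, (p < (frame_rank i).+1)%N, (q < (frame_rank i).+1)%N, p != q
    & x = frame_root i p q].
Proof.
move=> /L32_coords[z [-> par hot]] /eqP.
rewrite dot_embed (can2_eq (divfK _) (mulfK _)) ?pnatr_eq0//.
rewrite (_ : 2 * 4 = (8 : int)%:~R); last by ring.
move=> /eqP/intr_inj/(norm8_frame par hot)[i [p [q [i16 pi qi pq zE]]]].
exists i, p, q; split=> //.
by apply/matrixP => k j; rewrite !mxE zE.
Qed.

Lemma dot_root i p q j p' q' :
  (i < 16)%N -> (p < (frame_rank i).+1)%N -> (q < (frame_rank i).+1)%N ->
  (j < 16)%N -> (p' < (frame_rank j).+1)%N -> (q' < (frame_rank j).+1)%N ->
  dot (frame_root i p q) (frame_root j p' q') = if i == j then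
    ((p == p')%:R - (p == q')%:R - (q == p')%:R + (q == q')%:R) else 0.
Proof.
move=> i16 pi qi j16 pj qj; rewrite dot_embed wdotBl.
rewrite !(wdotC (frame i _)) !wdotBl !(wdotC (frame j _)).
have fE r s : (r < (frame_rank i).+1)%N -> (s < (frame_rank j).+1)%N ->
    wdot (frame i r) (frame j s) =
      if i == j then (r == s)%:R * 4 - (4 %/ (frame_rank i).+1)%N%:Z else 0.
  move=> ri sj; apply/eqP.
  have /all_belowP/(_ _ i16)/all_belowP/(_ _ j16) := frame_wdot.
  by move=> /all_belowP/(_ _ ri)/all_belowP/(_ _ sj).
rewrite !fE//; case: ifP => _; last by rewrite !subr0 mul0r.
by do 4 case: (_ == _); rewrite ?(rmorphB, rmorphM, rmorph0) /=; field.
Qed.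

(** By self-duality, integral pairings with the basis suffice, so the roots never have to be
    expressed in that basis. *)
Lemma root_L32 i p q : (i < 16)%N -> (p < (frame_rank i).+1)%N ->
  (q < (frame_rank i).+1)%N -> L32 (frame_root i p q).
Proof.
move=> i16 pi qi; apply: mem_int_span_dual Bmx_gram Gmx_inv _ => l.
rewrite col_Bmx dot_embed wdotC wdotBl.
have dual := elimT (all_belowP _ _) (elimT (all_belowP _ _) frame_dual _ i16).
have /all_belowP/(_ _ (ltn_ord l))/dvdz_witness[s hs] := dual _ pi.
have /all_belowP/(_ _ (ltn_ord l))/dvdz_witness[t ht] := dual _ qi.
apply/intrP; exists (s - t); rewrite (_ : _ - _ = (s - t) * 4) ?rmorphM/=.
  by field.
rewrite mulrBl -hs -ht; ring.
Qed.

Definition frame_mx i : 'M[R]_(32, (frame_rank i).+1) :=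
  \matrix_(k, p) (scale k * (frame i p k)%:~R).

Lemma frame_mx_root i (p q : 'I_(frame_rank i).+1) :
  frame_mx i *m (delta_mx p 0 - delta_mx q 0) = frame_root i p q.
Proof.
rewrite mulmxBr -!colE; apply/matrixP => k j.
by rewrite !mxE rmorphB/= mulrBr.
Qed.

Lemma dot_rootA m (p q p' q' : 'I_m.+1) :
  dot (delta_mx p 0 - delta_mx q 0 : 'cV[R]_m.+1)
      (delta_mx p' 0 - delta_mx q' 0) =
  (p == p')%:R - (p == q')%:R - (q == p')%:R + (q == q')%:R.
Proof.
have dotBl (x y z : 'cV[R]_m.+1) : dot (x - y) z = dot x z - dot y z.
  by rewrite -scaleN1r dotDl dotZl mulN1r.
have delta r s : dot (delta_mx r 0 : 'cV[R]_m.+1) (delta_mx s 0) = (r == s)%:R.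
  rewrite dotE (bigD1 r)//= big1 ?addr0 => [|k kr]; last first.
    by rewrite !mxE (negbTE kr) mul0r.
  by rewrite !mxE !eqxx /= andbT mul1r.
rewrite dotBl !(dotC (delta_mx _ _)) !dotBl !delta.
by rewrite !(eq_sym p') !(eq_sym q'); ring.
Qed.

Lemma L32_type : has_type_A (nseq 8 1%N ++ nseq 8 3%N) (norm2_vectors L32).
Proof.
exists (fun i => [set frame_mx i *m x | x in root_system_A (m := frame_rank i)]).
split.
- move=> i; exists (frame_mx i); split=> // x y [p [q [pq ->]]] [p' [q' [pq' ->]]].
  by rewrite !frame_mx_root dot_root ?ltn_ord// eqxx dot_rootA.
- move=> i j ij _ _ [x [p [q [_ ->]]] <-] [y [p' [q' [_ ->]]] <-].
  by rewrite !frame_mx_root dot_root ?ltn_ord// (negbTE (ij : (i : nat) != j)).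
- apply/seteqP; split=> [x [Lx x2]|_ [i [_ [p [q [pq ->]]] <-]]].
    have [i [p [q [i16 pi qi pq ->]]]] := norm2_L32_root Lx x2.
    exists (Ordinal i16), (delta_mx (Ordinal pi) 0 - delta_mx (Ordinal qi) 0).
      by exists (Ordinal pi), (Ordinal qi).
    by rewrite frame_mx_root.
  rewrite frame_mx_root; split; first by apply: root_L32; rewrite ltn_ord.
  rewrite dot_root ?ltn_ord// !eqxx (eq_sym (q : nat)).
  by rewrite (negbTE (pq : (p : nat) != q)) !subr0.
Qed.

End Lattice.

(** * The theta series *)

Section ExpBounds.
Context {R : realType}.

(** Four successive squarings of [expR (1/16) >= 17/16], rounded down to a simple fraction each
    time. *)
Lemma expR1_ge : 13 / 5 <= expR 1 :> R.
Proof.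
have a1 : 17 / 16 <= expR 16^-1 :> R by have := @expR_ge1Dx R 16^-1; lra.
have a2 : 79 / 70 <= expR 16^-1 ^+ 2 :> R by nra.
have a4 : 14 / 11 <= expR 16^-1 ^+ 2 ^+ 2 :> R by nra.
have a8 : 34 / 21 <= expR 16^-1 ^+ 2 ^+ 2 ^+ 2 :> R by nra.
have -> : expR 1 = expR 16^-1 ^+ 2 ^+ 2 ^+ 2 ^+ 2 :> R.
  by rewrite -!exprM -expRM_natl; congr expR; field.
nra.
Qed.

Lemma expR3_ge : 17 <= expR 3 :> R.
Proof.
have -> : expR 3 = expR 1 ^+ 3 :> R by rewrite -expRM_natl mulr1.
by have := expR1_ge; nra.
Qed.

Lemma expR_3_4_ge : 2 <= expR (3 / 4) :> R.
Proof.
have e0 := expR_ge0 (3 / 4 : R); rewrite -(@ler_pXn2r R 4)// ?nnegrE//.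
have -> : expR (3 / 4) ^+ 4 = expR 3 :> R.
  by rewrite -expRM_natl; congr expR; field.
by apply: le_trans expR3_ge; rewrite -natrX ler_nat.
Qed.

(** This is the square root of the inequality needed in the end, that the theta bound
    [2^16 (9/8)^32] is below [expR 16]. *)
Lemma expR8_gt : 2 ^+ 8 * (9 / 8) ^+ 16 < expR 8 :> R.
Proof.
have -> : expR 8 = expR 1 ^+ 2 ^+ 2 ^+ 2 :> R.
  by rewrite -!exprM -expRM_natl mulr1.
have e2 : 27 / 4 <= expR 1 ^+ 2 :> R by have := expR1_ge; nra.
have e4 : 45 <= expR 1 ^+ 2 ^+ 2 :> R by nra.
have e8 : 2000 <= expR 1 ^+ 2 ^+ 2 ^+ 2 :> R by nra.
apply: lt_le_trans e8.
have -> : (9 / 8) ^+ 16 = (9 / 8) ^+ 4 ^+ 2 ^+ 2 :> R by rewrite -!exprM.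
have c4 : (9 / 8) ^+ 4 <= 13 / 8 :> R by rewrite !exprS expr0; lra.
have c4' : 0 <= (9 / 8) ^+ 4 :> R by apply: exprn_ge0; lra.
have c8 : (9 / 8) ^+ 4 ^+ 2 <= 8 / 3 :> R by nra.
have c8' : 0 <= (9 / 8) ^+ 4 ^+ 2 :> R by nra.
have c16 : (9 / 8) ^+ 4 ^+ 2 ^+ 2 <= 64 / 9 :> R by nra.
have -> : 2 ^+ 8 = 256 :> R by rewrite -natrX.
lra.
Qed.

End ExpBounds.

Section Covering.
Context {R : numDomainType}.

(** Each element of [s] is charged to a preimage under [dec]; repeated values only enlarge the
    right-hand side. *)
Lemma big_cover_le (T : eqType) (I : finType) (dec : I -> T) (s : seq T)
    (f : T -> R) : uniq s -> (forall x, 0 <= f x) ->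
  (forall x, x \in s -> exists t, x = dec t) ->
  \sum_(x <- s) f x <= \sum_t f (dec t).
Proof.
move=> us f0 cov.
apply: (@le_trans _ _ (\sum_(x <- s) \sum_(t | x == dec t) f x)).
  rewrite big_seq [leRHS]big_seq; apply: ler_sum => x /cov[t xt].
  by rewrite (bigD1 t) ?xt ?eqxx//= lerDl sumr_ge0.
rewrite (exchange_big_dep xpredT)//=; apply: ler_sum => t _.
rewrite (eq_bigr (fun=> f (dec t))) => [|x /eqP->//].
rewrite big_const_seq iter_addr_0 (eq_count (a2 := pred1 (dec t)))//.
by rewrite count_uniq_mem//; case: (_ \in _); rewrite ?mulr0n ?mulr1n.
Qed.

End Covering.

(** * Majorant of the theta series by a sum over boxes *)

Section Theta.
Context {R : realType}.

(* Coordinates in the same parity class have the same parity in [L32]. Without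
   this constraint the bound on the theta series would be too large. *)
Definition parity_class (k : nat) : nat := (2 * (k %/ 4) + (k %% 4 != 0))%N.

Lemma parity_class_lt (k : 'I_32) : (parity_class k < 16)%N.
Proof. by rewrite /parity_class; have := ltn_ord k; case: (_ != _); lia. Qed.

(** The two signs parametrize disjoint halves of the integers, so that zero is counted once. *)
Definition signed_nat (s : bool) (m : nat) : int :=
  if s then m%:Z else - m.+1%:Z.

(** [t.1] holds the parities of the 16 classes and [t.2] the halved coordinates. Of the lattice
    condition only the parity constraint is kept. *)
Definition shell_coord N
    (t : {ffun 'I_16 -> bool} * {ffun 'I_32 -> bool * 'I_N}) (k : 'I_32) : int :=
  2 * signed_nat (t.2 k).1 (t.2 k).2 +
  (t.1 (Ordinal (parity_class_lt k)) : nat)%:Z.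

Definition shell_vec N t : 'cV[R]_32 :=
  \col_k (scale k * (@shell_coord N t k)%:~R).

(** Geometric majorants of [exp (- 3 v^2 / 4)] for [v = 2 n] and for [v] odd. They come from
    [n^2 >= n], [exp 3 >= 17] and [exp (3/4) >= 2]. *)
Definition coord_bound (p s : bool) (m : nat) : R :=
  if p then 2^-1 * 17^-1 ^+ m else if s then 17^-1 ^+ m else 17^-1 ^+ m.+1.

Lemma expRN3_le m : expR (- 3 * m%:R) <= 17^-1 ^+ m :> R.
Proof.
rewrite mulNr expRN [_ * m%:R]mulrC expRM_natl -exprVn.
rewrite lerXn2r ?nnegrE ?invr_ge0 ?expR_ge0//.
by rewrite lef_pV2 ?posrE ?expR_gt0 ?expR3_ge.
Qed.

Lemma scale_sqr_ge k : 4^-1 <= scale k ^+ 2 :> R.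
Proof.
rewrite expr2 sqr_scale /weight; case: (_ %% _)%N => [|_]; last by rewrite mul1r.
by rewrite ler_peMl// ler1n.
Qed.

Lemma coord_boundP k (p s : bool) m :
  expR (- 3 * (scale k * (2 * signed_nat s m + (p : nat)%:Z)%:~R) ^+ 2)
    <= coord_bound p s m.
Proof.
pose v : int := 2 * signed_nat s m + (p : nat)%:Z.
have h (x : R) : 4 * x <= v%:~R ^+ 2 ->
    expR (- 3 * (scale k * v%:~R) ^+ 2) <= expR (- 3 * x).
  move=> vx; rewrite ler_expR !mulNr lerN2 ler_pM2l// exprMn.
  have := scale_sqr_ge k; have : 0 <= (v%:~R : R) ^+ 2 by exact: sqr_ge0.
  by move: (scale k ^+ 2) (v%:~R ^+ 2) vx => a b vx b0 a0; nra.
rewrite -/v /coord_bound; case: p @v h => v h.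
  apply: le_trans (h (m%:R + 4^-1) _) _.
    rewrite -rmorphXn/= (_ : 4 * _ = (4 * m%:Z + 1)%:~R); last first.
      by rewrite rmorphD rmorphM/=; field.
    by rewrite ler_int /v /signed_nat; case: (s); nia.
  rewrite mulrDr expRD [leRHS]mulrC.
  apply: ler_pM; rewrite ?expR_ge0//; first exact: expRN3_le.
  by rewrite mulNr expRN lef_pV2 ?posrE ?expR_gt0 ?expR_3_4_ge.
have hs (n : nat) : n%:Z * n%:Z * 4 = v * v ->
    expR (- 3 * (scale k * v%:~R) ^+ 2) <= 17^-1 ^+ n :> R.
  move=> nv; apply: (le_trans (h n%:R _)); last exact: expRN3_le.
  rewrite -rmorphXn/= (_ : 4 * _ = (4 * n%:Z)%:~R); last by rewrite rmorphM.
  by rewrite ler_int expr2 -nv; nia.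
by case: ifP => sE; apply: hs; rewrite /v sE /signed_nat; lia.
Qed.

(** Even coordinates sum to at most 17/16 + 1/16 = 9/8, odd ones to at most 2 * (1/2) * (17/16). *)
Lemma sum_coord_bound N p :
  \sum_(w : bool * 'I_N) coord_bound p w.1 w.2 <= 9 / 8.
Proof.
have geom : \sum_(m < N) (17^-1 : R) ^+ m <= 17 / 16.
  suff -> : \sum_(m < N) (17^-1 : R) ^+ m = 17 / 16 * (1 - 17^-1 ^+ N).
    have : 0 <= (17^-1 : R) ^+ N by rewrite exprn_ge0// invr_ge0.
    by lra.
  elim: (N) => [|n IH]; first by rewrite big_ord0 expr0; lra.
  by rewrite big_ord_recr/= IH exprS; lra.
rewrite -(pair_bigA _ (fun s (m : 'I_N) => coord_bound p s m))/= big_bool/=.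
rewrite /coord_bound; case: p; first by rewrite -!mulr_sumr; lra.
under [X in _ + X]eq_bigr do rewrite exprS.
by rewrite -mulr_sumr; lra.
Qed.

(** For fixed parities the sum factors over the 32 coordinates, each factor being at most 9/8; there
    are 2^16 choices of parities. *)
Lemma shell_sum N :
  \sum_t expR (- 3 * dot (shell_vec t) (@shell_vec N t))
    <= 2 ^+ 16 * (9 / 8) ^+ 32.
Proof.
apply: (@le_trans _ _
  (\sum_(t : {ffun 'I_16 -> bool} * {ffun 'I_32 -> bool * 'I_N}) \prod_k
    coord_bound (t.1 (Ordinal (parity_class_lt k))) (t.2 k).1 (t.2 k).2)).
  apply: ler_sum => t _; rewrite dotE mulr_sumr expR_sum.
  apply: ler_prod => k _; rewrite expR_ge0/= -expr2 mxE.
  exact: coord_boundP.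
rewrite -(pair_bigA _ (fun (p : {ffun 'I_16 -> bool})
  (w : {ffun 'I_32 -> bool * 'I_N}) => \prod_(k < 32) coord_bound
  (p (Ordinal (parity_class_lt k))) (w k).1 (w k).2))/=.
apply: (@le_trans _ _ (\sum_(p : {ffun 'I_16 -> bool}) (9 / 8) ^+ 32)).
  apply: ler_sum => p _; rewrite -(bigA_distr_bigA
    (fun (k : 'I_32) (w : bool * 'I_N) => coord_bound
    (p (Ordinal (parity_class_lt k))) w.1 w.2)).
  apply: (@le_trans _ _ (\prod_(k < 32) (9 / 8))).
    apply: ler_prod => k _; rewrite sum_coord_bound andbT.
    apply: sumr_ge0 => w _; rewrite /coord_bound.
    by case: (p _) => //; case: w.1; rewrite ?mulr_ge0 ?exprn_ge0 ?invr_ge0.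
  by rewrite prodr_const card_ord.
by rewrite sumr_const card_ffun card_bool card_ord -[leLHS]mulr_natl natrX.
Qed.

Lemma shell_vec_cover N z : same_parity z ->
  (forall k : 'I_32, (`|z k| < N)%N) -> exists t, embed z = @shell_vec N t.
Proof.
move=> /all_belowP par zN.
(* A coordinate that represents parity class [j]. *)
pose rep (j : nat) := (4 * j./2 + odd j)%N.
pose p := [ffun j : 'I_16 => ~~ (2 %| z (rep j))%Z].
pose w (k : 'I_32) : int :=
  ((z k - (p (Ordinal (parity_class_lt k)) : nat)%:Z) %/ 2)%Z.
have wE (k : 'I_32) :
    z k = 2 * w k + (p (Ordinal (parity_class_lt k)) : nat)%:Z.
  suff : (2 %| z k - (p (Ordinal (parity_class_lt k)) : nat)%:Z)%Z.
    by move=> /divzK; rewrite /w; lia.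
  rewrite ffunE /= (_ : rep _ = (4 * (k %/ 4) + (k %% 4 != 0))%N); last first.
    by rewrite /rep /parity_class; case: (_ != _); lia.
  have k4 : (k %/ 4 < 8)%N by rewrite ltn_divLR.
  have : (2 %| z (4 * (k %/ 4) + (k %% 4 != 0))%N - z k)%Z.
    have : (k %% 4 < 4)%N by rewrite ltn_mod.
    have -> : z k = z (4 * (k %/ 4) + k %% 4)%N by rewrite mulnC -divn_eq.
    move: (par _ k4) => /andP[].
    case: (k %% 4)%N => [|[|[|[|]]]]//=; rewrite ?addn0 ?addn1 ?addn2 ?addn3.
    - by rewrite subrr.
    - by rewrite subrr.
    - by [].
    - by [].
  move: (z k) (z _); lia.
(* The predecessor matches the shift by one of [signed_nat] on negative integers. *)
have wN (k : 'I_32) : ((if (0 <= w k)%R then `|w k| else `|w k|.-1) < N)%N.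
  have := zN k; rewrite wE; case: (p _) => /=; case: ifP; lia.
exists (p, [ffun k => (0 <= w k, Ordinal (wN k))]).
apply/matrixP => k j; rewrite !mxE /shell_coord /= wE.
congr (_ * (2 * _ + _)%:~R); rewrite ffunE /signed_nat /=.
move: (w k) => v; case: ifP => v0; rewrite v0; lia.
Qed.

(** A finite set of lattice vectors lies in some box; the size [N] of the box depends on the set,
    the bound does not. *)
Lemma theta_L32 (s : seq 'cV[R]_32) : uniq s -> (forall x, x \in s -> L32 x) ->
  \sum_(x <- s) expR (- 3 * dot x x) <= 2 ^+ 16 * (9 / 8) ^+ 32.
Proof.
move=> us sL.
have [N cov] : exists N, forall x, x \in s -> exists t, x = @shell_vec N t.
  have [N bd] : exists N, forall x, x \in s ->
      exists2 z, x = embed z & same_parity z /\ forall k : 'I_32, (`|z k| < N)%N.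
    elim: s sL {us} => [|x s IH] sL; first by exists 0%N.
    have [|N hN] := IH; first by move=> y ys; apply: sL; rewrite inE ys orbT.
    have [z [xz par _]] := L32_coords (sL x (mem_head _ _)).
    exists (maxn N (\max_(k < 32) `|z k|).+1) => y.
    rewrite inE => /predU1P[->|/hN].
      exists z => //; split=> // k; rewrite leq_max; apply/orP; right.
      by rewrite ltnS (leq_bigmax k).
    move=> [z' yz' [par' z'N]]; exists z' => //; split=> // k.
    by rewrite leq_max z'N.
  by exists N => x /bd[z -> [par zN]]; apply: shell_vec_cover.
apply: le_trans (shell_sum N).
by apply: (big_cover_le (dec := @shell_vec N)) => // x; exact: expR_ge0.
Qed.

End Theta.

(** * The derivative of the energy *)

Section DominatedSums.
Context {R : realType} {T : choiceType}.
Variables (D : set T) (th : T -> R) (K : R).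
Hypothesis th_sum : forall s : seq T, uniq s -> (forall x, x \in s -> D x) ->
  \sum_(x <- s) th x <= K.

Definition rsum (g : T -> R) : R := fine (\esum_(x in D) (g x)%:E).

(** The class on which [rsum] is the true finite sum: non-negativity makes the extended sum
    monotone, and the multiple of [th] makes it finite. *)
Definition dominated (g : T -> R) : Prop :=
  (forall x, 0 <= g x) /\ exists2 C, 0 <= C & forall x, D x -> g x <= C * th x.

Lemma esum_le_seq (g : T -> R) M :
  (forall s : seq T, uniq s -> (forall x, x \in s -> D x) ->
    \sum_(x <- s) g x <= M) ->
  (\esum_(x in D) (g x)%:E <= M%:E)%E.
Proof.
move=> h; apply: ge_ereal_sup => _ [A [Afin AD] <-].
rewrite fsbig_finite//= sumEFin lee_fin.
apply: h => [|x]; first exact: fset_uniq.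
by rewrite in_fset_set// => /set_mem/AD.
Qed.

Lemma seq_le_esum (g : T -> R) (s : seq T) : (forall x, 0 <= g x) ->
  uniq s -> (forall x, x \in s -> D x) ->
  ((\sum_(x <- s) g x)%:E <= \esum_(x in D) (g x)%:E)%E.
Proof.
move=> g0 us sD; apply: esum_ge; exists [set` s].
  by split=> // x /sD.
by rewrite -sumEFin fsbig_seq.
Qed.

Lemma dominated_fin g : dominated g ->
  (\esum_(x in D) (g x)%:E)%E = (rsum g)%:E.
Proof.
move=> [g0 [C C0 gC]]; rewrite /rsum fineK// ge0_fin_numE; last first.
  by apply: esum_ge0 => x _; rewrite lee_fin.
apply: (@le_lt_trans _ _ (C * K)%:E); last by rewrite ltry.
apply: esum_le_seq => s us sD; apply: le_trans (ler_wpM2l C0 (th_sum us sD)).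
by rewrite mulr_sumr big_seq [leRHS]big_seq; apply: ler_sum => x /sD/gC.
Qed.

Lemma rsum_le_seq g M : dominated g ->
  (forall s : seq T, uniq s -> (forall x, x \in s -> D x) ->
    \sum_(x <- s) g x <= M) -> rsum g <= M.
Proof. by move=> dg /esum_le_seq; rewrite dominated_fin// lee_fin. Qed.

Lemma seq_le_rsum g (s : seq T) : dominated g -> uniq s ->
  (forall x, x \in s -> D x) -> \sum_(x <- s) g x <= rsum g.
Proof.
by move=> dg us /(seq_le_esum dg.1 us); rewrite dominated_fin// lee_fin.
Qed.

Lemma rsum_ge0 g : dominated g -> 0 <= rsum g.
Proof.
move=> dg; rewrite (le_trans _ (seq_le_rsum (s := [::]) dg _ _))//.
by rewrite big_nil.
Qed.

Lemma rsum_le_th g C : dominated g -> 0 <= C ->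
  (forall x, D x -> g x <= C * th x) -> rsum g <= C * K.
Proof.
move=> dg C0 gC; apply: rsum_le_seq => // s us sD.
apply: le_trans (ler_wpM2l C0 (th_sum us sD)).
by rewrite mulr_sumr big_seq [leRHS]big_seq; apply: ler_sum => x /sD/gC.
Qed.

Lemma dominatedD g g' : dominated g -> dominated g' -> dominated (g \+ g').
Proof.
move=> [g0 [C C0 gC]] [g0' [C' C0' gC']]; split=> [x|].
  by rewrite addr_ge0.
exists (C + C') => [|x Dx]; first exact: addr_ge0.
by rewrite mulrDl lerD ?gC ?gC'.
Qed.

Lemma dominatedZ c g : 0 <= c -> dominated g -> dominated (fun x => c * g x).
Proof.
move=> c0 [g0 [C C0 gC]]; split=> [x|]; first by rewrite mulr_ge0.
by exists (c * C) => [|x Dx]; rewrite -?mulrA ?mulr_ge0 ?ler_wpM2l ?gC.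
Qed.

Lemma rsumD g g' : dominated g -> dominated g' ->
  rsum (g \+ g') = rsum g + rsum g'.
Proof.
move=> dg dg'; apply: EFin_inj; rewrite EFinD -!dominated_fin//.
  by rewrite -esumD// => x _; rewrite lee_fin; [exact: dg.1|exact: dg'.1].
exact: dominatedD.
Qed.

Lemma rsumZ c g : 0 <= c -> dominated g ->
  rsum (fun x => c * g x) = c * rsum g.
Proof.
(* One inequality suffices: applied to [c^-1] and [c * g] it yields the converse. *)
have le c' g' : 0 <= c' -> dominated g' ->
    rsum (fun x => c' * g' x) <= c' * rsum g'.
  move=> c0 dg; apply: rsum_le_seq => [|s us sD]; first exact: dominatedZ.
  by rewrite -mulr_sumr ler_wpM2l// seq_le_rsum.
rewrite le_eqVlt => /predU1P[<-|c0] dg.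
  apply/eqP; rewrite eq_le le//= mul0r rsum_ge0//; exact: dominatedZ.
apply/eqP; rewrite eq_le le ?(ltW c0)//= -ler_pdivlMl//.
rewrite [leLHS](_ : _ = rsum (fun x => c^-1 * (c * g x))); last first.
  by congr rsum; apply/funext => x; rewrite mulKf ?gt_eqF.
by apply: le; rewrite ?invr_ge0 ?(ltW c0)//; apply: dominatedZ => //; exact: ltW.
Qed.

End DominatedSums.

(** Multiplying [1 - s <= expR (- s)] by [expR s] gives [expR s - 1 <= s * expR s]; the upper bound
    then follows according to the sign of [s]. *)
Lemma expR_taylor1 {R : realType} (s : R) :
  0 <= expR s - 1 - s <= s ^+ 2 * expR `|s|.
Proof.
have e1 := expR_ge1Dx s; have e2 := expR_ge1Dx (- s); have E0 := expR_gt0 s.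
have EN : expR s * expR (- s) = 1 by rewrite -expRD subrr expR0.
apply/andP; split; first by lra.
have h1 : expR s - 1 <= s * expR s.
  by have := ler_wpM2l (ltW E0) e2; rewrite EN; lra.
have [s0|s0] := lerP 0 s.
  by have := ler_wpM2l s0 h1; rewrite ger0_norm// expr2; lra.
have n1 : 1 <= expR `|s| by rewrite -expR0 ler_expR.
have h2 : s ^+ 2 <= s ^+ 2 * expR `|s| by rewrite ler_peMr ?sqr_ge0.
have : s * (expR s - 1) <= s * s by rewrite ler_nM2l//; lra.
by move: h2; rewrite expr2; lra.
Qed.

(** * First-order expansion of a Gaussian sum, with summed remainder *)

Section GaussianDerivative.
Context {R : realType} {T : choiceType}.
Variables (D : set T) (t a b : T -> R) (K : R).
Hypothesis t_sum : forall s : seq T, uniq s -> (forall x, x \in s -> D x) ->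
  \sum_(x <- s) expR (- 3 * t x) <= K.
Hypothesis a_ge0 : forall x, 0 <= a x.
Hypothesis b_ge0 : forall x, 0 <= b x.
Hypothesis ab_le : forall x, a x + b x <= t x.

Let th x := expR (- 3 * t x).
Let w x := expR (- 14 * t x).
Let f h x := expR (- 14 * (t x + h * (a x - b x))).
Let r h x := f h x - w x + 14 * h * (a x - b x) * w x.

Lemma t_ge0 x : 0 <= t x.
Proof. by apply: le_trans (ab_le x); rewrite addr_ge0. Qed.

Lemma mul_weight_le u x : 0 <= u <= t x -> u * w x <= th x.
Proof.
move=> /andP[u0 ut]; apply: (@le_trans _ _ (expR (t x) * w x)).
  rewrite ler_wpM2r ?expR_ge0// (le_trans ut)// (le_trans _ (expR_ge1Dx _))//.
  by rewrite lerDr.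
by rewrite -expRD ler_expR; have := t_ge0 x; lra.
Qed.

Lemma dominated_weight : dominated D th w.
Proof.
split=> [x|]; first exact: expR_ge0.
by exists 1 => // x _; rewrite mul1r ler_expR; have := t_ge0 x; lra.
Qed.

Lemma dominated_aw : dominated D th (fun x => a x * w x).
Proof.
split=> [x|]; first by rewrite mulr_ge0 ?expR_ge0.
exists 1 => // x _; rewrite mul1r mul_weight_le// a_ge0/=.
by have := ab_le x; have := b_ge0 x; lra.
Qed.

Lemma dominated_bw : dominated D th (fun x => b x * w x).
Proof.
split=> [x|]; first by rewrite mulr_ge0 ?expR_ge0.
exists 1 => // x _; rewrite mul1r mul_weight_le// b_ge0/=.
by have := ab_le x; have := a_ge0 x; lra.
Qed.

(** For [|h| <= 1/14] the perturbation of the exponent is at most [t x], which leaves at most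
    [- 13 * t x]. *)
Lemma dominated_f h : `|h| <= 14^-1 -> dominated D th (f h).
Proof.
move=> h14; split=> [x|]; first exact: expR_ge0.
exists 1 => // x _; rewrite mul1r ler_expR.
have : `|h * (a x - b x)| <= 14^-1 * t x.
  rewrite normrM ler_pM// ler_norml.
  by have := (a_ge0 x, b_ge0 x, ab_le x) => -[[? ?] ?]; apply/andP; split; lra.
by rewrite ler_norml => /andP[? ?]; have := t_ge0 x; lra.
Qed.

(** The Taylor bound with [|s| <= 14 |h| t] and [|s| <= t] gives at most [(14 h)^2 t^2 exp t] times
    the weight. As [t^2 <= exp (2 t)], the exponent [- 14 t + 3 t] is still below [- 3 t]. *)
Lemma remainder_bound h x : `|h| <= 14^-1 ->
  0 <= r h x <= (14 * h) ^+ 2 * th x.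
Proof.
move=> h14; set q := a x - b x; set s := - 14 * h * q.
have qt : `|q| <= t x.
  rewrite ler_norml; have := (a_ge0 x, b_ge0 x, ab_le x) => -[[? ?] ?].
  by apply/andP; split; rewrite /q; lra.
have st : `|s| <= 14 * `|h| * t x.
  by rewrite /s !normrM normrN (@ger0_norm _ 14)// ler_wpM2l ?mulr_ge0.
have st' : `|s| <= t x.
  by apply: (le_trans st); rewrite ler_piMl ?t_ge0//; lra.
have -> : r h x = w x * (expR s - 1 - s).
  rewrite /r /f -/q mulrDr expRD -/(w x) (_ : - 14 * (h * q) = s) /s; ring.
have h20 : 0 <= (14 * h) ^+ 2 := sqr_ge0 _.
have [/andP[p0 p1] w0] := (expR_taylor1 s, expR_gt0 (- 14 * t x)).
apply/andP; split; first by rewrite mulr_ge0// ltW.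
apply: (@le_trans _ _
  (w x * ((14 * h) ^+ 2 * (expR (t x) * expR (t x)) * expR (t x)))).
  rewrite ler_pM2l// (le_trans p1)// ler_pM ?expR_ge0 ?sqr_ge0 ?ler_expR//.
  rewrite -(real_normK (num_real s)).
  apply: (@le_trans _ _ ((14 * `|h| * t x) ^+ 2)).
    by rewrite lerXn2r ?nnegrE// mulr_ge0 ?t_ge0// mulr_ge0.
  rewrite exprMn (_ : (14 * `|h|) ^+ 2 = (14 * h) ^+ 2); last first.
    by rewrite !exprMn real_normK ?num_real.
  rewrite ler_wpM2l// -?expr2 ?lerXn2r ?nnegrE ?t_ge0 ?expR_ge0//.
  by rewrite (le_trans _ (expR_ge1Dx _))// lerDr.
rewrite [leLHS](_ : _ = (14 * h) ^+ 2 *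
  (w x * (expR (t x) * expR (t x) * expR (t x)))); last by ring.
rewrite ler_wpM2l// /w -!expRD ler_expR.
by have := t_ge0 x; lra.
Qed.

Lemma rsum_taylor1 h : `|h| <= 14^-1 ->
  `|rsum D (f h) - rsum D w + 14 * h *
     (rsum D (fun x => a x * w x) - rsum D (fun x => b x * w x))|
  <= (14 * h) ^+ 2 * K.
Proof.
move=> h14.
have rb x := remainder_bound x h14.
have dr : dominated D th (r h).
  split=> [x|]; first by case/andP: (rb x).
  exists ((14 * h) ^+ 2) => [|x _]; first exact: sqr_ge0.
  by case/andP: (rb x).
have [da db dw df] :=
  And4 dominated_aw dominated_bw dominated_weight (dominated_f h14).
have h1 : 0 <= 14 * (`|h| + h) by have := ler_norm (- h); rewrite normrN; lra.
have h2 : 0 <= 14 * (`|h| - h) by have := ler_norm h; lra.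
have h3 : 0 <= 14 * `|h| by rewrite mulr_ge0.
pose aw x := a x * w x; pose bw x := b x * w x.
(* Adding [14 |h| (a + b) w] to both sides makes all summands non-negative. *)
have : rsum D (f h \+ ((fun x => 14 * (`|h| + h) * aw x) \+
                       (fun x => 14 * (`|h| - h) * bw x))) =
       rsum D (r h \+ (w \+ ((fun x => 14 * `|h| * aw x) \+
                       (fun x => 14 * `|h| * bw x)))).
  by congr rsum; apply/funext => x /=; rewrite /r /aw /bw; ring.
have dZ c g : 0 <= c -> dominated D th g -> dominated D th (fun x => c * g x).
  exact: dominatedZ.
have dD g g' : dominated D th g -> dominated D th g' -> dominated D th (g \+ g').
  exact: dominatedD.
move: (r h) dr rb => g dr rb.
have dS c c' : 0 <= c -> 0 <= c' ->
    dominated D th ((fun x => c * aw x) \+ (fun x => c' * bw x)).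
  by move=> c0 c'0; apply: dD; apply: dZ.
have rS c c' : 0 <= c -> 0 <= c' ->
    rsum D ((fun x => c * aw x) \+ (fun x => c' * bw x)) =
    c * rsum D aw + c' * rsum D bw.
  by move=> c0 c'0; rewrite (rsumD t_sum) ?(rsumZ t_sum)//; exact: dZ.
rewrite (rsumD t_sum df (dS _ _ h1 h2)).
rewrite (rsumD t_sum dr (dD _ _ dw (dS _ _ h3 h3))).
rewrite (rsumD t_sum dw (dS _ _ h3 h3)) !rS//.
have R0 : 0 <= rsum D g by apply: rsum_ge0 t_sum _ dr.
have RK : rsum D g <= (14 * h) ^+ 2 * K.
  apply: (rsum_le_th t_sum dr) => [|x _]; first exact: sqr_ge0.
  by case/andP: (rb x).
move=> E; apply: le_trans RK.
rewrite -/aw -/bw (_ : _ + _ = rsum D g) ?ger0_norm//.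
by move: E; lra.
Qed.

End GaussianDerivative.

Lemma cvg_quotient_taylor1 {R : realType} (F : R -> R) (l C d : R) :
  0 < d -> 0 <= C ->
  (forall h, `|h| <= d -> `|F h - F 0 - h * l| <= C * h ^+ 2) ->
  h^-1 *: (F h - F 0) @[h --> 0^'] --> l.
Proof.
move=> d0 C0 hF; apply/cvgrPdist_le => e e0; near=> h.
have h0 : h != 0 by near: h; exact: nbhs_dnbhs_neq.
have hd : `|h| <= d by near: h; apply: dnbhs0_le.
(* The increment to [C + 1] keeps the denominator positive when [C = 0]. *)
have he : `|h| <= e / (C + 1).
  by near: h; apply: dnbhs0_le; rewrite divr_gt0// ltr_wpDl.
have := hF _ hd.
have -> : F h - F 0 - h * l = - (h * (l - h^-1 *: (F h - F 0))).
  by rewrite /GRing.scale/=; field.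
rewrite normrN normrM -real_normK ?num_real// expr2 mulrCA ler_pM2l ?normr_gt0//.
move=> /le_trans; apply; rewrite mulrC.
move: he; rewrite ler_pdivlMr ?ltr_wpDl// mulrDr mulr1.
by have := normr_ge0 h; lra.
Unshelve. all: by end_near.
Qed.

(** * Comparison of two coordinates of [L32] and failure of criticality *)

Section NotCritical.
Context {R : realType}.

Let i0 : 'I_32 := ord0.
Let i1 : 'I_32 := inord 1.
Let D : set 'cV[R]_32 := L32 `\ 0.
Let H : 'M[R]_32 := delta_mx i0 i0 - delta_mx i1 i1.
Let t (x : 'cV[R]_32) := dot x x.
Let a (x : 'cV[R]_32) := x i0 0 ^+ 2.
Let b (x : 'cV[R]_32) := x i1 0 ^+ 2.
Let w (x : 'cV[R]_32) := expR (- 14 * t x).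
Let K : R := 2 ^+ 16 * (9 / 8) ^+ 32.

Lemma i1_neq : i1 != i0.
Proof. by rewrite -val_eqE /= inordK. Qed.

Lemma theta_D (s : seq 'cV[R]_32) : uniq s -> (forall x, x \in s -> D x) ->
  \sum_(x <- s) expR (- 3 * t x) <= K.
Proof. by move=> us sD; apply: theta_L32 => // x /sD[]. Qed.

Lemma coords_le_dot x : a x + b x <= t x.
Proof.
rewrite /t dotE (bigD1 i0)//= (bigD1 i1) ?i1_neq//= addrA -!expr2 lerDl.
by rewrite sumr_ge0// => j _; rewrite -expr2 sqr_ge0.
Qed.

Lemma qform_near_id h x : qform (h *: H + 1%:M) x = t x + h * (a x - b x).
Proof.
rewrite /qform mulmxDr mulmxDl mulmx1 mxE addrC; congr (_ + _).
rewrite -scalemxAr -scalemxAl mxE mulmxBr mulmxBl !mxE; congr (_ * (_ - _)).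
  rewrite (bigD1 i0)//= big1 ?addr0 => [|j /negbTE j0]; last first.
    by rewrite !mxE big1 ?mul0r// => k _; rewrite !mxE j0 andbF mulr0.
  rewrite !mxE (bigD1 i0)//= big1 ?addr0 => [|j /negbTE j0]; last first.
    by rewrite !mxE j0 mulr0.
  by rewrite !mxE !eqxx mulr1 -expr2.
rewrite (bigD1 i1)//= big1 ?addr0 => [|j /negbTE j0]; last first.
  by rewrite !mxE big1 ?mul0r// => k _; rewrite !mxE j0 andbF mulr0.
rewrite !mxE (bigD1 i1)//= big1 ?addr0 => [|j /negbTE j0]; last first.
  by rewrite !mxE j0 mulr0.
by rewrite !mxE !eqxx mulr1 -expr2.
Qed.

Lemma energyE h : energy 14 L32 (h *: H + 1%:M) =
  rsum D (fun x => expR (- 14 * (t x + h * (a x - b x)))).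
Proof.
by congr (fine _); apply: eq_esum => x _; rewrite /gaussian qform_near_id.
Qed.

Lemma derive_energy : 'D_H (energy 14 L32) (1%:M : 'M[R]_32) =
  - 14 * (rsum D (fun x => a x * w x) - rsum D (fun x => b x * w x)).
Proof.
(* Convergence of the difference quotient is proved, so the value is not the default of a missing
   limit. *)
apply: cvg_lim => //.
pose F h := energy 14 L32 (h *: H + 1%:M).
have F0 : F 0 = energy 14 L32 (1%:M : 'M[R]_32) by rewrite /F scale0r add0r.
rewrite [X in X @ _ --> _](_ : _ = fun h : R => h^-1 *: (F h - F 0)); last first.
  by rewrite F0.
have K0 : 0 <= K by rewrite mulr_ge0// exprn_ge0.
apply: (@cvg_quotient_taylor1 _ _ _ (14 ^+ 2 * K) 14^-1).
- by rewrite invr_gt0.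
- exact: (mulr_ge0 (sqr_ge0 _)).
move=> h h14.
have a0 x : 0 <= a x by exact: sqr_ge0.
have b0 x : 0 <= b x by exact: sqr_ge0.
rewrite [leRHS](_ : _ = (14 * h) ^+ 2 * K); last by rewrite exprMn mulrAC.
have := rsum_taylor1 theta_D a0 b0 coords_le_dot h14.
congr (is_true (`|_| <= _)); rewrite /F !energyE.
have -> : (fun x => expR (- 14 * (t x + 0 * (a x - b x)))) = w.
  by apply/funext => x; rewrite mul0r addr0.
by rewrite /w; ring.
Qed.

(** Two roots of one component have inner product 2 only if their ordered pairs of frame indices
    agree. *)
Lemma root_inj i p q p' q' : (i < 16)%N ->
  (p < (frame_rank i).+1)%N -> (q < (frame_rank i).+1)%N -> p != q ->
  (p' < (frame_rank i).+1)%N -> (q' < (frame_rank i).+1)%N ->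
  frame_root i p q = frame_root i p' q' :> 'cV[R]_32 -> (p, q) = (p', q').
Proof.
move=> i16 pi qi pq pi' qi' E.
have := dot_root (R := R) i16 pi qi i16 pi' qi'; rewrite -E dot_root// !eqxx.
rewrite (negbTE pq) eq_sym (negbTE pq).
case: (eqVneq p p') => [->|_]; case: (eqVneq q q') => [->//|_] /= e;
  exfalso; move: e; do ?case: (_ == _) => /=; lra.
Qed.

Lemma dot_root2 i p q : (i < 16)%N -> (p < (frame_rank i).+1)%N ->
  (q < (frame_rank i).+1)%N -> p != q ->
  dot (frame_root i p q) (frame_root i p q) = 2 :> R.
Proof.
move=> i16 pi qi pq; rewrite dot_root// !eqxx (negbTE pq) eq_sym (negbTE pq).
by rewrite !subr0.
Qed.

Lemma root_D i p q : (i < 16)%N -> (p < (frame_rank i).+1)%N ->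
  (q < (frame_rank i).+1)%N -> p != q -> D (frame_root i p q).
Proof.
move=> i16 pi qi pq; split; first exact: root_L32.
by move=> /= /eqP; rewrite -dotxx_eq0 dot_root2// pnatr_eq0.
Qed.

(** At coordinate 1 the frame vectors 0 and 1 have entry 1, and 2 and 3 have entry -1. These pairs
    join opposite signs and give the eight A3 roots with [x_1 ^ 2 = 1]. *)
Definition A3_pairs : seq (nat * nat) :=
  [:: (0, 2); (0, 3); (1, 2); (1, 3); (2, 0); (3, 0); (2, 1); (3, 1)]%N.

Lemma rsum_b_ge : 8 * expR (- 28) <= rsum D (fun x => b x * w x).
Proof.
have ok : all (fun pq => [&& pq.1 < 4, pq.2 < 4 & pq.1 != pq.2]%N) A3_pairs by [].
(* Component 8 is the A3 of block 0. *)
pose s : seq 'cV[R]_32 := [seq frame_root 8 pq.1 pq.2 | pq <- A3_pairs].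
have db : dominated D (fun x => expR (- 3 * t x)) (fun x => b x * w x).
  by apply: dominated_bw coords_le_dot => x; exact: sqr_ge0.
have us : uniq s.
  rewrite map_inj_in_uniq// => -[p q] [p' q'] /(allP ok)/and3P[/= p4 q4 pq].
  by move=> /(allP ok)/and3P[/= p4' q4' _]; apply: root_inj.
have sD x : x \in s -> D x.
  by move=> /mapP[[p q] /(allP ok)/and3P[/= p4 q4 pq] ->]; apply: root_D.
apply: le_trans (seq_le_rsum theta_D db us sD).
have val x : x \in s -> b x * w x = expR (- 28).
  move=> /mapP[[p q] hpq ->]; have /and3P[/= p4 q4 pq] := allP ok _ hpq.
  rewrite /w /t dot_root2// (_ : - 14 * 2 = - 28); last by ring.
  rewrite /b mxE inordK// /scale /= exprMn -rmorphXn/=.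
  have -> : (frame 8 p 1 - frame 8 q 1) ^+ 2 = 4.
    move: hpq; rewrite !inE; do 7 (case/orP => [/eqP[-> ->]//|]).
    by move=> /eqP[-> ->].
  by rewrite (_ : 2^-1 ^+ 2 * _ = 1) ?mul1r//; field.
rewrite big_seq (eq_bigr _ val) -big_seq big_map big_const_seq iter_addr_0.
by rewrite -[leRHS]mulr_natl.
Qed.

Lemma root_coord0 (x : 'cV[R]_32) i p q : x = frame_root i p q ->
  (i < 16)%N -> (p < (frame_rank i).+1)%N -> (q < (frame_rank i).+1)%N ->
  p != q -> x i0 0 != 0 ->
  a x = 2 /\ ((x == frame_root 0 0 1) || (x == frame_root 0 1 0)).
Proof.
case: i => [|i] ->; rewrite /a !mxE => i16 pi qi pq; last first.
  (* Component 8 shares block 0 with component 0, but its frame vanishes at coordinate 0; the other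
     components lie in other blocks. *)
  have [i7|i7] := eqVneq i 7%N; last first.
    suff z r : frame i.+1 r i0 = 0 by rewrite !z subrr mulr0 eqxx.
    by rewrite /frame /= ifN//; move: i16 i7; lia.
  rewrite {}i7 in pi qi *.
  suff z r : (r < 4)%N -> frame 8 r i0 = 0 by rewrite !z// subrr mulr0 eqxx.
  by case: r => [|[|[|[|]]]].
move=> _; rewrite exprMn expr2 sqr_scale -rmorphXn/=.
case: p q pi qi pq => [|[|p]] [|[|q]]//= _ _ _.
- split; last by apply/orP; left; apply: eqxx.
  by rewrite (_ : weight 0 = 2)// (_ : (_ - _) ^+ 2 = 4)//; field.
- split; last by apply/orP; right; apply: eqxx.
  by rewrite (_ : weight 0 = 2)// (_ : (_ - _) ^+ 2 = 4)//; field.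
Qed.

Lemma rsum_a_le :
  rsum D (fun x => a x * w x) <= 4 * expR (- 28) + 4 * expR (- 44) * K.
Proof.
have a0 x : 0 <= a x by exact: sqr_ge0.
have da : dominated D (fun x => expR (- 3 * t x)) (fun x => a x * w x).
  by apply: dominated_aw coords_le_dot => // x; exact: sqr_ge0.
apply: (rsum_le_seq theta_D da) => s us sD.
pose r1 : 'cV[R]_32 := frame_root 0 0 1; pose r2 : 'cV[R]_32 := frame_root 0 1 0.
(* Termwise majorant: the two A1 roots of block 0 contribute [2 exp (- 28)] each, and the theta term
   covers the vectors of norm at least 4. *)
apply: (@le_trans _ _ (\sum_(x <- s) (2 * expR (- 28) * (x == r1)%:R +
    2 * expR (- 28) * (x == r2)%:R + 4 * expR (- 44) * expR (- 3 * t x)))).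
  rewrite big_seq [leRHS]big_seq; apply: ler_sum => x /sD[Lx /eqP x0].
  have e28 := expR_ge0 (- 28 : R); have e44 := expR_ge0 (- 44 : R).
  have tail0 : 0 <= 4 * expR (- 44) * expR (- 3 * t x).
    by rewrite !mulr_ge0 ?expR_ge0.
  have [x2|x2] := eqVneq (dot x x) 2.
    have [i [p [q [i16 pi qi pq xE]]]] := norm2_L32_root Lx x2.
    have [z|nz] := eqVneq (x i0 0) 0.
      by rewrite /a z expr0n/= mul0r addr_ge0// addr_ge0// mulr_ge0// mulr_ge0.
    have [-> r] := root_coord0 xE i16 pi qi pq nz.
    rewrite /w /t x2 (_ : - 14 * 2 = - 28); last by ring.
    move: (expR (- 28)) e28 tail0; rewrite /t x2 => e e28 tail0.
    by case/orP: r => ->; case: (_ == _); rewrite ?mulr1 ?mulr0; lra.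
  have t4 := dotxx_L32_ge4 Lx x0 x2.
  apply: (@le_trans _ _ (4 * expR (- 44) * expR (- 3 * t x))); last first.
    by rewrite lerDr addr_ge0// mulr_ge0// mulr_ge0.
  have at_ : a x <= t x.
    by have := coords_le_dot x; have := sqr_ge0 (x i1 0); rewrite -/(b x); lra.
  (* For [t >= 4] one has [t <= 4 (t - 3) <= 4 exp (t - 4)], and [t - 4 - 14 t <= - 44 - 3 t]. *)
  apply: (@le_trans _ _ (4 * expR (t x - 4) * w x)).
    rewrite ler_wpM2r ?expR_ge0// (le_trans at_)//.
    by have := expR_ge1Dx (t x - 4); rewrite /t in t4 *; lra.
  rewrite -!mulrA ler_wpM2l// /w -!expRD ler_expR.
  by rewrite /t in t4 *; lra.
rewrite !big_split/= -!mulr_sumr; apply: lerD; last first.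
  by rewrite ler_wpM2l ?mulr_ge0 ?expR_ge0// theta_D.
have count1 r : \sum_(x <- s) (x == r)%:R <= 1 :> R.
  rewrite -natr_sum -big_mkcond/= sum1_count count_uniq_mem// lern1.
  by case: (_ \in _).
have e28 := expR_ge0 (- 28 : R).
by have := count1 r1; have := count1 r2; nra.
Qed.

Lemma L32_not_critical : ~ critical 14 (L32 : set 'cV[R]_32).
Proof.
move=> /(_ H) h.
have HT : H^T = H by rewrite linearB/= !trmx_delta.
have Htr : \tr H = 0.
  rewrite linearB/= /mxtrace; apply/eqP; rewrite subr_eq0; apply/eqP.
  rewrite (bigD1 i0)//= big1 => [|j /negbTE j0]; last by rewrite !mxE j0.
  rewrite (bigD1 i1)//= big1 => [|j /negbTE j0]; last by rewrite !mxE j0.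
  by rewrite !mxE !eqxx.
have := h HT Htr; rewrite derive_energy => /eqP; apply/negP.
have KE : K < expR 16.
  have := @expR8_gt R; set Q := 2 ^+ 8 * _ => Q8.
  have -> : K = Q ^+ 2 by rewrite /K /Q [RHS]exprMn -!exprM.
  have -> : expR 16 = expR 8 ^+ 2 :> R by rewrite -expRM_natl -natrM.
  by rewrite ltrXn2r// ?nnegrE ?mulr_ge0 ?exprn_ge0 ?expR_ge0.
have e28 : expR (- 28) = expR (- 44) * expR 16 :> R.
  by rewrite -expRD; congr expR; ring.
have e44 := expR_gt0 (- 44 : R).
(* The tail is thus below [4 exp (- 28)], so the sum for [a] is strictly below [8 exp (- 28)], a
   lower bound of the sum for [b]. *)
have : expR (- 44) * K < expR (- 28) by rewrite e28 ltr_pM2l.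
by have := rsum_a_le; have := rsum_b_ge => A B C; rewrite mulf_neq0//; lra.
Qed.

End NotCritical.

Theorem mainTheorem4 (R : realType) :
  exists L : set 'cV[R]_32,
    [/\ is_lattice L,
        unimodular L,
        even_lattice L,
        has_type_A (nseq 8 1%N ++ nseq 8 3%N) (norm2_vectors L)
      & ~ critical 14 L].
Proof.
exists L32; split; [exact: L32_lattice|exact: L32_unimodular|exact: L32_even|
  exact: L32_type|exact: L32_not_critical].
Qed.
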